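(* Consider problem (P) and Algorithm 3.1 as described in the context, and let $\{(x_k,\rho_k,d_k,\xi_k,\lambda_k,r_k,W_k)\}$ be a sequence generated by Algorithm 3.1. Then: (1) For every $k$, $\theta'_{\rho_k,r_k}(x_k;d_k)\le -d_k^TW_kd_k$, and, provided Assumption 3.1 holds, $d_k$ is a descent direction of $\theta_{\rho_k,r_k}$ at $x_k$. (2) Suppose further that Assumption 3.1 holds, that the algorithm does not terminate within finitely many iterations, and that the sequences $\{x_k\}$, $\{\lambda_k\}$ and $\{r_k\}$ are bounded. Then $\bar K:=\{k:\|d_k\|\le\hat\eta\rho_k^{-1}\}$ is an infinite set and every accumulation point of $\{x_k\}_{k\in\bar K}$ is a (Clarke) stationary point of problem (P).
   Context: Problem (P): minimize $f(x)$ subject to $g_i(x)\le 0$ ($i=1,\dots,p$), $h_j(x)=0$ ($j=p+1,\dots,q$), where $f,g_i,h_j:\mathbb{R}^n\to\mathbb{R}$ are locally Lipschitz. $\partial$ denotes the Clarke generalized gradient. For feasible $\bar x$, $I(\bar x)=\{i:g_i(\bar x)=0\}$. A feasible $\bar x$ is a (Clarke) stationary point of (P) if there are $\lambda_i\ge0$ ($i\in I(\bar x)$) and $\lambda_j\in\mathbb{R}$ ($j=p+1,\dots,q$) with $0\in\partial f(\bar x)+\sum_{i\in I(\bar x)}\lambda_i\partial g_i(\bar x)+\sum_{j=p+1}^q\lambda_j\partial h_j(\bar x)$. Smoothing: $\{f_\rho\},\{g^i_\rho\},\{h^j_\rho\}$ ($\rho>0$) are families of continuously differentiable functions with $\lim_{z\to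 x,\rho\uparrow\infty}f_\rho(z)=f(x)$ etc. for all $x$, and (standing assumption) each family has the gradient consistency property: for every $x$, the set of all limits $\lim_k\nabla f_{\rho_k}(z_k)$ with $z_k\to x$, $\rho_k\uparrow\infty$ is nonempty and contained in $\partial f(x)$ (similarly for $g^i_\rho$, $h^j_\rho$). Subproblem $(\mathrm{QP})_k$: minimize over $(d,\xi)\in\mathbb{R}^n\times\mathbb{R}$ the function $\nabla f_{\rho_k}(x_k)^Td+\frac12 d^TW_kd+r_k\xi$ subject to $g^i_{\rho_k}(x_k)+\nabla g^i_{\rho_k}(x_k)^Td\le\xi$ ($i=1,\dots,p$), $h^j_{\rho_k}(x_k)+\nabla h^j_{\rho_k}(x_k)^Td\le\xi$ and $-h^j_{\rho_k}(x_k)-\nabla h^j_{\rho_k}(x_k)^Td\le\xi$ ($j=p+1,\dots,q$), $\xi\ge0$. A solution $(d_k,\xi_k)$ comes with a Lagrange (KKT) multiplier $\lambda_k=(\lambda^g_k,\lambda^+_k,\lambda^-_k,\lambda^\xi_k)\ge0$ satisfying $0=\nabla f_{\rho_k}(x_k)+W_kd_k+\sum_i\lambda^g_{i,k}\nabla g^i_{\rho_k}(x_k)+\sum_j(\lambda^+_{j,k}-\lambda^-_{j,k})\nabla h^j_{\rho_k}(x_k)$, $r_k=\sum_i\lambda^g_{i,k}+\sum_j(\lambda^+_{j,k}+\lambda^-_{j,k})+\lambda^\xi_k$, and complementarity of each multiplier with its constraint. Merit function: $\theta_{\rho,r}(x)=f_\rho(x)+r\phi_\rho(x)$, $\phi_\rho(x)=\max\{0,g^i_\rho(x)\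 (i=1,\dots,p),|h^j_\rho(x)|\ (j=p+1,\dots,q)\}$; $\theta'(x;d)$ is the directional derivative. Algorithm 3.1: constants $\beta,\sigma_1,\sigma_2\in(0,1)$ with $\sigma_1\le\sigma_2$, $\sigma,\sigma',\hat\eta\in(1,\infty)$; initial $x_0$, $\rho_0>0$, $r_0>0$, symmetric positive definite $W_0$; $k:=0$. Step 1: solve $(\mathrm{QP})_k$ to get $(d_k,\xi_k)$ and multiplier $\lambda_k$. Step 2: if $\xi_k=0$ set $r_{k+1}=r_k$, else $r_{k+1}=\sigma'r_k$. Step 3: $x_{k+1}=x_k+\alpha_kd_k$ with $\alpha_k=\beta^l$, $l$ the smallest nonnegative integer with $\theta_{\rho_k,r_k}(x_{k+1})-\theta_{\rho_k,r_k}(x_k)\le-\sigma_1\alpha_kd_k^TW_kd_k$. If $\|d_k\|\le\hat\eta\rho_k^{-1}$, set $\rho_{k+1}=\sigma\rho_k$ and go to Step 4; otherwise set $\rho_{k+1}=\rho_k$ and go to Step 1. In either case choose a symmetric positive definite $W_{k+1}$ and set $k:=k+1$. Step 4: if a stopping criterion holds, terminate; otherwise go to Step 1. Assumption 3.1: there exist constants $0<m<M$ with $m\|d\|^2\le d^TW_kd\le M\|d\|^2$ for all $k$ and all $d\in\mathbb{R}^n$.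
   Formalization: In part (1), the claim that d_k is a descent direction is stated only for d_k ≠ 0, since for d_k = 0 (possible, e.g. at a stationary iterate) no strict descent can occur. *)

(* Defs.v *)
From HB Require Import structures.
From mathcomp Require Import all_boot all_order all_algebra.
From mathcomp Require Import all_classical all_reals all_analysis.
Set Implicit Arguments. Unset Strict Implicit. Unset Printing Implicit Defensive.
Import Order.TTheory GRing.Theory Num.Theory.
Import numFieldNormedType.Exports.
Local Open Scope classical_set_scope.
Local Open Scope ring_scope.

Section Defs.
Variable R : realType.
Variable n : nat.
Local Notation vec := 'cV[R]_n.

Definition dotv (u v : vec) : R := (u^T *m v) 0 0.
Definition enorm (u : vec) : R := Num.sqrt (dotv u u).
Definition quadf (W : 'M[R]_n) (d : vec) : R := (d^T *m W *m d) 0 0.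

Definition locally_lipschitz (F : vec -> R) : Prop :=
  forall x, exists L delta : R, 0 < delta /\
    forall y z, enorm (y - x) < delta -> enorm (z - x) < delta ->
      `|F y - F z| <= L * enorm (y - z).

(** Clarke generalized directional derivative
      F°(x; v) = limsup_{y -> x, t downarrow 0} (F (y + t v) - F y) / t;
    [clarke_dd_ge F x v a] is the literal unfolding of  F°(x; v) >= a. *)
Definition clarke_dd_ge (F : vec -> R) (x v : vec) (a : R) : Prop :=
  forall eps delta : R, 0 < eps -> 0 < delta ->
    exists (y : vec) (t : R), enorm (y - x) < delta /\ 0 < t < delta /\
      a - eps < (F (y + t *: v) - F y) / t.

Definition clarke_grad (F : vec -> R) (x : vec) : set vec :=
  [set z | forall v, clarke_dd_ge F x v (dotv z v)].

Definition C1_with_grad (F : vec -> R) (G : vec -> vec) : Prop :=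
  (forall x, differentiable F x /\ ('d F x : vec -> R) = (fun h => dotv (G x) h))
  /\ continuous G.

Definition smoothing_family (F : vec -> R) (Fs : R -> vec -> R)
    (G : R -> vec -> vec) : Prop :=
  (forall rho, 0 < rho -> C1_with_grad (Fs rho) (G rho)) /\
  (forall x (eps : R), 0 < eps -> exists delta M : R, 0 < delta /\
     forall z rho, enorm (z - x) < delta -> M < rho -> `|Fs rho z - F x| < eps) /\
  (forall x,
     (exists (z : nat -> vec) (rho : nat -> R) (v : vec),
        z @ \oo --> x /\ rho @ \oo --> +oo /\
        (fun k => G (rho k) (z k)) @ \oo --> v) /\
     (forall (z : nat -> vec) (rho : nat -> R) (v : vec),
        z @ \oo --> x -> rho @ \oo --> +oo ->
        (fun k => G (rho k) (z k)) @ \oo --> v -> clarke_grad F x v)).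

Definition dir_deriv (F : vec -> R) (x d : vec) (l : R) : Prop :=
  (fun t : R => (F (x + t *: d) - F x) / t) @ 0^'+ --> l.

Definition descent_direction (F : vec -> R) (x d : vec) : Prop :=
  exists tau : R, 0 < tau /\ forall t : R, 0 < t <= tau -> F (x + t *: d) < F x.

Definition sym_posdef (W : 'M[R]_n) : Prop :=
  W^T = W /\ forall d : vec, d != 0 -> 0 < quadf W d.

Variables p me : nat. (* p inequality constraints, me = q - p equality constraints *)

Definition feasible (g : 'I_p -> vec -> R) (h : 'I_me -> vec -> R) (x : vec) :=
  (forall i, g i x <= 0) /\ (forall j, h j x = 0).

Definition stationary (f : vec -> R) (g : 'I_p -> vec -> R)
    (h : 'I_me -> vec -> R) (x : vec) : Prop :=
  feasible g h x /\
  exists (lg : 'I_p -> R) (lh : 'I_me -> R) (zf : vec) (zg : 'I_p -> vec)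
         (zh : 'I_me -> vec),
    clarke_grad f x zf /\
    (forall i, g i x = 0 -> 0 <= lg i /\ clarke_grad (g i) x (zg i)) /\
    (forall j, clarke_grad (h j) x (zh j)) /\
    zf + \sum_(i < p | g i x == 0) lg i *: zg i + \sum_(j < me) lh j *: zh j = 0.

Section Smoothed.
Variables (fs : R -> vec -> R) (gs : 'I_p -> R -> vec -> R)
          (hs : 'I_me -> R -> vec -> R).
Variables (Gf : R -> vec -> vec) (Gg : 'I_p -> R -> vec -> vec)
          (Gh : 'I_me -> R -> vec -> vec).

Definition phi_s (rho : R) (x : vec) : R :=
  Num.max (\big[Num.max/0]_(i < p) gs i rho x)
          (\big[Num.max/0]_(j < me) `|hs j rho x|).

Definition theta (rho r : R) (x : vec) : R := fs rho x + r * phi_s rho x.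

Definition qp_feasible (rho : R) (x : vec) (d : vec) (xi : R) : Prop :=
  (forall i, gs i rho x + dotv (Gg i rho x) d <= xi) /\
  (forall j, hs j rho x + dotv (Gh j rho x) d <= xi /\
             - hs j rho x - dotv (Gh j rho x) d <= xi) /\
  0 <= xi.

Definition qp_obj (rho : R) (x : vec) (W : 'M[R]_n) (r : R) (d : vec) (xi : R) : R :=
  dotv (Gf rho x) d + quadf W d / 2 + r * xi.

Definition qp_solution (rho : R) (x : vec) (W : 'M[R]_n) (r : R) (d : vec) (xi : R) :=
  qp_feasible rho x d xi /\
  forall d' xi', qp_feasible rho x d' xi' ->
    qp_obj rho x W r d xi <= qp_obj rho x W r d' xi'.

Definition qp_kkt (rho : R) (x : vec) (W : 'M[R]_n) (r : R) (d : vec) (xi : R)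
    (lg : 'I_p -> R) (lp lm : 'I_me -> R) (lx : R) : Prop :=
  (forall i, 0 <= lg i) /\ (forall j, 0 <= lp j /\ 0 <= lm j) /\ 0 <= lx /\
  Gf rho x + W *m d + \sum_(i < p) lg i *: Gg i rho x
    + \sum_(j < me) (lp j - lm j) *: Gh j rho x = 0 /\
  r = \sum_(i < p) lg i + \sum_(j < me) (lp j + lm j) + lx /\
  (forall i, lg i * (gs i rho x + dotv (Gg i rho x) d - xi) = 0) /\
  (forall j, lp j * (hs j rho x + dotv (Gh j rho x) d - xi) = 0 /\
             lm j * (- hs j rho x - dotv (Gh j rho x) d - xi) = 0) /\
  lx * xi = 0.

Definition alg31_upto (beta sigma1 sigma2 sigma sigma' etahat : R)
    (x : nat -> vec) (rho : nat -> R) (d : nat -> vec) (xi : nat -> R)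
    (lg : nat -> 'I_p -> R) (lp lm : nat -> 'I_me -> R) (lx : nat -> R)
    (r : nat -> R) (W : nat -> 'M[R]_n) (K : nat) : Prop :=
  [/\ 0 < beta < 1, 0 < sigma1 < 1, 0 < sigma2 < 1, sigma1 <= sigma2 &
      [/\ 1 < sigma, 1 < sigma' & 1 < etahat]] /\
  0 < rho 0%N /\ 0 < r 0%N /\
  (forall k, (k <= K)%N ->
     sym_posdef (W k) /\
     qp_solution (rho k) (x k) (W k) (r k) (d k) (xi k) /\
     qp_kkt (rho k) (x k) (W k) (r k) (d k) (xi k) (lg k) (lp k) (lm k) (lx k)) /\
  (forall k, (k < K)%N ->
     [/\ r k.+1 = (if xi k == 0 then r k else sigma' * r k),
         (let armijo (a : R) :=
            theta (rho k) (r k) (x k + a *: d k) - theta (rho k) (r k) (x k)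
              <= - sigma1 * a * quadf (W k) (d k) in
          exists l : nat,
            [/\ x k.+1 = x k + beta ^+ l *: d k, armijo (beta ^+ l) &
                forall l' : nat, (l' < l)%N -> ~ armijo (beta ^+ l')])
       & rho k.+1 = (if enorm (d k) <= etahat / rho k then sigma * rho k
                     else rho k)]).

End Smoothed.

Definition assumption31 (W : nat -> 'M[R]_n) : Prop :=
  exists m M : R, 0 < m < M /\
    forall k (d : vec), m * enorm d ^+ 2 <= quadf (W k) d <= M * enorm d ^+ 2.

End Defs.

(* Main.v *)
(** Part (1): complementarity turns the stationarity equation of the quadratic
    program into [grad f . d + r (xi - phi) <= - d^T W d], and feasibility of
    [(d, xi)] bounds the slope of [phi] along [d] by [xi - phi].

    Part (2): a bounded penalty sequence is eventually constant, with [xi = 0].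
    If [|d_k| <= etahat / rho_k] held only finitely often, [rho] would be
    eventually constant too and the steps bounded away from [0]; near an
    accumulation point the estimate of part (1) is uniform, so all small trial
    steps pass the Armijo test, contradicting the convergence of the merit
    values. Hence [rho_k] tends to infinity, [d_k] tends to [0] along the
    infinite index set, and one passes to the limit in the KKT system.

    Passing to the limit needs bounded gradients, which gradient consistency
    does not state but implies. The smoothed functions have, arbitrarily close
    to any point, gradients of norm below [2 L + 1], with [L] a Lipschitz
    constant of the limit function (minimize the function plus a steep quadratic);
    if larger gradients also occurred, by connectedness there would be gradients
    of norm exactly [2 L + 2] at points converging to the given one, and a limit
    of these is a Clarke subgradient of norm larger than [L]. *)

Require Import Defs.
From HB Require Import structures.
From mathcomp Require Import all_boot all_order all_algebra.
From mathcomp Require Import all_classical all_reals all_analysis.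
From mathcomp Require Import ring lra.
Import Order.TTheory GRing.Theory Num.Theory.
Import numFieldNormedType.Exports.
Local Open Scope classical_set_scope.
Local Open Scope ring_scope.

(** * Euclidean inner product and norm, compared with the ambient topology *)

Section Euclidean.
Context {R : realType} {n : nat}.
Implicit Types (u v w : 'cV[R]_n) (W : 'M[R]_n).

Lemma dotvE u v : dotv u v = \sum_i u i 0 * v i 0.
Proof. by rewrite /dotv mxE; apply: eq_bigr => i _; rewrite mxE. Qed.

Lemma dotvC u v : dotv u v = dotv v u.
Proof. by rewrite !dotvE; apply: eq_bigr => i _; rewrite mulrC. Qed.

Lemma dotvDr u v w : dotv u (v + w) = dotv u v + dotv u w.
Proof. by rewrite /dotv mulmxDr mxE. Qed.

Lemma dotvDl u v w : dotv (u + v) w = dotv u w + dotv v w.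
Proof. by rewrite !(dotvC _ w) dotvDr. Qed.

Lemma dotvZr a u v : dotv u (a *: v) = a * dotv u v.
Proof. by rewrite /dotv -scalemxAr mxE. Qed.

Lemma dotvZl a u v : dotv (a *: u) v = a * dotv u v.
Proof. by rewrite dotvC dotvZr dotvC. Qed.

Lemma dotvNr u v : dotv u (- v) = - dotv u v.
Proof. by rewrite -scaleN1r dotvZr mulN1r. Qed.

Lemma dotvNl u v : dotv (- u) v = - dotv u v.
Proof. by rewrite dotvC dotvNr dotvC. Qed.

Lemma dotv0l v : dotv 0 v = 0.
Proof. by rewrite -(scale0r (0 : 'cV[R]_n)) dotvZl mul0r. Qed.

Lemma dotv_suml (I : finType) (F : I -> 'cV[R]_n) v :
  dotv (\sum_i F i) v = \sum_i dotv (F i) v.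
Proof.
by apply: (big_morph (fun u => dotv u v)) => [a b|]; rewrite ?dotvDl ?dotv0l.
Qed.

Lemma dotv_ge0 u : 0 <= dotv u u.
Proof. by rewrite dotvE; apply: sumr_ge0 => i _; rewrite -expr2 sqr_ge0. Qed.

Lemma enorm_ge0 u : 0 <= enorm u.
Proof. exact: sqrtr_ge0. Qed.

Lemma sqr_enorm u : enorm u ^+ 2 = dotv u u.
Proof. by rewrite sqr_sqrtr // dotv_ge0. Qed.

Lemma enormZ a u : enorm (a *: u) = `|a| * enorm u.
Proof.
by rewrite /enorm dotvZl dotvZr mulrA -expr2 sqrtrM ?sqr_ge0 // sqrtr_sqr.
Qed.

Lemma enorm0 : enorm (0 : 'cV[R]_n) = 0.
Proof. by rewrite /enorm dotv0l sqrtr0. Qed.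

Lemma enormN u : enorm (- u) = enorm u.
Proof. by rewrite -scaleN1r enormZ normrN1 mul1r. Qed.

Lemma enormBC u v : enorm (u - v) = enorm (v - u).
Proof. by rewrite -enormN opprB. Qed.

Lemma coord_le_enorm u i : `|u i 0| <= enorm u.
Proof.
rewrite -sqrtr_sqr ler_wsqrtr // dotvE (bigD1 i) //= -expr2 lerDl.
by apply: sumr_ge0 => j _; rewrite -expr2 sqr_ge0.
Qed.

Lemma enorm_eq0 u : enorm u = 0 -> u = 0.
Proof.
move=> u0; apply/matrixP => i j; rewrite ord1 mxE; apply/eqP.
by rewrite -normr_le0 -u0 coord_le_enorm.
Qed.

Lemma enorm_gt0 u : u != 0 -> 0 < enorm u.
Proof.
by rewrite lt0r enorm_ge0 andbT; apply: contra_neq => /enorm_eq0.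
Qed.

(** Expand the nonnegative square of the norm of [enorm v *: u - enorm u *: v] and divide by
    [enorm u * enorm v]; zero vectors are treated apart. *)
Lemma cauchy_schwarz u v : dotv u v <= enorm u * enorm v.
Proof.
have [u0|up] := eqVneq u 0; first by rewrite u0 dotv0l enorm0 mul0r.
have := dotv_ge0 (enorm v *: u - enorm u *: v).
rewrite dotvDl !dotvDr !dotvNl !dotvNr !dotvZl !dotvZr (dotvC v u) -!sqr_enorm.
have [v0|vp] := eqVneq v 0; first by rewrite v0 dotvC dotv0l enorm0 mulr0.
have := enorm_gt0 _ up; have := enorm_gt0 _ vp.
move: (enorm u) (enorm v) (dotv u v) => a b c bp ap H.
have ab : 0 < a * b by rewrite mulr_gt0.
rewrite -(ler_pM2l ab); nra.
Qed.

Lemma normr_dotv_le u v : `|dotv u v| <= enorm u * enorm v.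
Proof.
by rewrite ler_norml lerNl -dotvNl -{1}enormN !cauchy_schwarz.
Qed.

Lemma enormD u v : enorm (u + v) <= enorm u + enorm v.
Proof.
rewrite -(ler_pXn2r (ltn0Sn 1)) ?nnegrE ?addr_ge0 ?enorm_ge0 //.
rewrite sqr_enorm dotvDl !dotvDr (dotvC v u) -!sqr_enorm.
have := cauchy_schwarz u v; lra.
Qed.

Lemma enorm_dist_trans v u w : enorm (u - w) <= enorm (u - v) + enorm (v - w).
Proof. by apply: le_trans (enormD _ _); rewrite addrA subrK. Qed.

Lemma ler_enormB u v : enorm u - enorm v <= enorm (u - v).
Proof. by rewrite lerBlDr -{1}(subrK v u) enormD. Qed.

Lemma enorm_sum (I : finType) (F : I -> 'cV[R]_n) :
  enorm (\sum_i F i) <= \sum_i enorm (F i).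
Proof.
elim/big_ind2: _ => [|a b c d ab cd|//]; first by rewrite enorm0.
exact: le_trans (enormD _ _) (lerD ab cd).
Qed.

Lemma normr_le_enorm u : `|u| <= enorm u.
Proof.
rewrite [leLHS]/Num.Def.normr /= mx_normrE; apply: bigmax_le => [|[i j] _] /=.
  exact: enorm_ge0.
by rewrite ord1 coord_le_enorm.
Qed.

Lemma enorm_le_normr u : enorm u <= n%:R * `|u|.
Proof.
have cu i : `|u i 0| <= `|u|.
  rewrite [leRHS]/Num.Def.normr /= mx_normrE.
  by apply/bigmax_geP; right; exists (i, 0).
rewrite -(ler_pXn2r (ltn0Sn 1)) ?nnegrE ?mulr_ge0 ?enorm_ge0 //.
rewrite sqr_enorm dotvE exprMn.
have -> : n%:R ^+ 2 * `|u| ^+ 2 = n%:R * \sum_(i < n) `|u| ^+ 2.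
  by rewrite sumr_const card_ord -[X in _ = _ * X]mulr_natl expr2 mulrA.
(* Passing from the factor [n] to its square uses [1 <= n], so dimension zero is separate. *)
case: (posnP n) => [n0|n0].
  rewrite big1 => [|[i ilt] _]; last by exfalso; move: ilt; rewrite n0.
  by rewrite mulr_ge0 // sumr_ge0 // => i _; exact: exprn_ge0.
apply: (@le_trans _ _ (\sum_(i < n) `|u| ^+ 2)).
  apply: ler_sum => i _; rewrite -expr2 -real_normK ?num_real //.
  by rewrite ler_pXn2r ?nnegrE.
by rewrite ler_peMl ?ler1n // sumr_ge0 // => i _; exact: exprn_ge0.
Qed.

(** The ambient topology comes from the maximum norm; the two comparisons above make Euclidean balls
    describe the same convergence. *)
Lemma cvg_enormP {T : Type} {F : set_system T} {FF : Filter F}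
    (z : T -> 'cV[R]_n) u :
  z @ F --> u <-> forall eps : R, 0 < eps -> \forall k \near F, enorm (z k - u) < eps.
Proof.
split.
  move=> /cvgrPdist_lt zu eps e0.
  (* Dividing by [n.+1] instead of [n] keeps the radius meaningful in dimension zero. *)
  have e1 : 0 < eps / n.+1%:R by rewrite divr_gt0.
  have := zu _ e1; apply: filterS => k Hk.
  apply: le_lt_trans (enorm_le_normr _) _.
  rewrite -opprB normrN; apply: le_lt_trans (_ : n.+1%:R * `|u - z k| < _).
    by rewrite ler_wpM2r // ler_nat.
  by rewrite mulrC -ltr_pdivlMr.
move=> H; apply/cvgrPdist_lt => eps e0.
have := H _ e0; apply: filterS => k; apply: le_lt_trans.
by rewrite -opprB normrN normr_le_enorm.
Qed.

Lemma nbhs_enormP u (P : set 'cV[R]_n) :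
  nbhs u P <-> exists2 del : R, 0 < del & forall v, enorm (v - u) < del -> P v.
Proof.
split.
  move=> /nbhs_ballP[e /= e0 Pe]; exists e => // v uv; apply: Pe.
  rewrite -ball_normE /ball_ /=; apply: le_lt_trans uv.
  by rewrite -opprB normrN normr_le_enorm.
case=> del d0 Pd.
have /cvg_enormP/(_ _ d0) : id @ u --> u by exact: cvg_id.
exact: filterS.
Qed.

Lemma cvg_enorm {T : Type} {F : set_system T} {FF : Filter F}
    (z : T -> 'cV[R]_n) u :
  z @ F --> u -> (fun k => enorm (z k)) @ F --> enorm u.
Proof.
move=> /cvg_enormP zu; apply/cvgrPdist_lt => eps e0.
have := zu _ e0; apply: filterS => k; apply: le_lt_trans.
by rewrite ler_norml lerNl opprB ler_enormB enormBC ler_enormB.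
Qed.

Lemma cvg_coord {T : Type} {F : set_system T} {FF : Filter F}
    (z : T -> 'cV[R]_n) u :
  (forall i, (fun k => z k i 0) @ F --> u i 0) -> z @ F --> u.
Proof.
move=> H; apply/cvgrPdist_lt => eps e0.
have : \forall k \near F, forall i, `|u i 0 - z k i 0| < eps.
  by apply: filter_forall => i; have /cvgrPdist_lt := H i; apply.
apply: filterS => k Hk.
rewrite [ltLHS]/Num.Def.normr /= mx_normrE; apply: bigmax_lt => [//|[i j] _] /=.
by rewrite ord1 !mxE.
Qed.

Lemma continuous_line u v (t : R) : {for t, continuous (fun s : R => u + s *: v)}.
Proof. by apply: cvgD; [exact: cvg_cst|apply: cvgZl; exact: cvg_id]. Qed.

Lemma quadfE W u : quadf W u = dotv u (W *m u).
Proof. by rewrite /quadf /dotv mulmxA. Qed.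

Lemma quadfD W u v : W^T = W ->
  quadf W (u + v) = quadf W u + 2 * dotv u (W *m v) + quadf W v.
Proof.
move=> WT; rewrite !quadfE mulmxDr dotvDl !dotvDr.
have -> : dotv v (W *m u) = dotv u (W *m v).
  by rewrite dotvC /dotv trmx_mul WT mulmxA.
ring.
Qed.

(* Polarization: [4 u.(W v) = q(u + v) - q(u - v) <= M |u + v|^2] for [u] a
   rescaling of [W v] to the length of [v]. *)
Lemma enorm_mulmx_le W M v : W^T = W ->
  (forall u, 0 <= quadf W u <= M * enorm u ^+ 2) -> enorm (W *m v) <= M * enorm v.
Proof.
move=> WT HW.
have [->|v0] := eqVneq v 0; first by rewrite mulmx0 enorm0 mulr0.
have [->|w0] := eqVneq (W *m v) 0.
  have := HW v; have := enorm_gt0 _ v0; rewrite enorm0.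
  move=> v1 /andP[q0 q1]; have := le_trans q0 q1.
  by rewrite pmulr_lge0 ?exprn_gt0 // => M0; rewrite mulr_ge0 // ltW.
have vp := enorm_gt0 _ v0; have wp := enorm_gt0 _ w0.
set u := (enorm v / enorm (W *m v)) *: (W *m v).
have nu : enorm u = enorm v.
  by rewrite enormZ ger0_norm ?divr_ge0 ?enorm_ge0 // divfK // gt_eqF.
have H1 := quadfD W u v WT; have H2 := quadfD W u (- v) WT.
have /andP[_ q1] := HW (u + v); have /andP[q2 _] := HW (u - v).
rewrite mulmxN dotvNr in H2.
have N : quadf W (- v) = quadf W v by rewrite !quadfE mulmxN dotvNr dotvNl opprK.
have E1 : dotv u (W *m v) = enorm v * enorm (W *m v).
  by rewrite dotvZl -sqr_enorm; field; rewrite gt_eqF.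
have M0 : 0 <= M.
  have /andP[a b] := HW v; have := le_trans a b.
  by rewrite pmulr_lge0 ?exprn_gt0.
have E2 : enorm (u + v) ^+ 2 <= 4 * enorm v ^+ 2.
  have := enormD u v; rewrite nu; have := enorm_ge0 (u + v).
  move: (enorm _) (enorm v) vp => a b *; nra.
have q3 : quadf W (u + v) <= M * (4 * enorm v ^+ 2).
  exact: le_trans q1 (ler_wpM2l M0 E2).
rewrite -(ler_pM2l vp); rewrite E1 in H1 H2; rewrite N in H2.
nra.
Qed.

End Euclidean.

(** * One-sided directional derivatives of maxima *)

Section DirectionalDerivative.
Context {R : realType} {n : nat}.
Implicit Types (F G : 'cV[R]_n -> R) (x d : 'cV[R]_n).

Lemma ler_dist_max (a b c e : R) :
  `|Num.max a b - Num.max c e| <= Num.max `|a - c| `|b - e|.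
Proof.
have : `|b - e| <= Num.max `|a - c| `|b - e| by rewrite le_max lexx orbT.
have : `|a - c| <= Num.max `|a - c| `|b - e| by rewrite le_max lexx.
move: (Num.max `|_| _) => M; rewrite !ler_norml => /andP[? ?] /andP[? ?].
by apply/andP; case: (ltP a b) => ?; case: (ltP c e) => ?; split; lra.
Qed.

Lemma cvg_max {T : Type} {F : set_system T} {FF : Filter F} (u v : T -> R) a b :
  u @ F --> a -> v @ F --> b ->
  (fun t => Num.max (u t) (v t)) @ F --> Num.max a b.
Proof.
move=> /cvgrPdist_lt ua /cvgrPdist_lt vb; apply/cvgrPdist_lt => eps e0.
have := vb _ e0; have := ua _ e0; apply: filterS2 => t ut vt.
by rewrite (le_lt_trans (ler_dist_max _ _ _ _)) // gt_max ut.
Qed.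

Lemma dir_deriv_cvg F x d l : dir_deriv F x d l ->
  (fun t : R => F (x + t *: d)) @ 0^'+ --> F x.
Proof.
move=> Fl.
have : (fun t : R => F x + t * ((F (x + t *: d) - F x) / t)) @ 0^'+ --> F x + 0 * l.
  apply: cvgD; first exact: cvg_cst.
  by apply: cvgM Fl; apply: cvg_at_right_filter; exact: cvg_id.
rewrite mul0r addr0; apply: cvg_trans; apply: near_eq_cvg.
near=> t; have t0 : 0 < t by near: t; exact: nbhs_right_gt.
by rewrite mulrC divfK ?gt_eqF // addrC subrK.
Unshelve. all: by end_near. Qed.

(* Written [l <= c - F x] because the bound is then stable under [Num.max],
   whichever of the two functions is active at [x]. *)
Definition dir_deriv_le F x d (c : R) :=
  exists l : R, dir_deriv F x d l /\ l <= c - F x.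

(** Both functions are right-continuous along [d], so the strict inequality persists for small steps
    and the maximum coincides with [F] there. *)
Lemma dir_deriv_max_gt F G x d l l' : G x < F x ->
  dir_deriv F x d l -> dir_deriv G x d l' ->
  dir_deriv (fun y => Num.max (F y) (G y)) x d l.
Proof.
move=> GF Fl Gl'; apply: cvg_trans (Fl); apply: near_eq_cvg.
have : (fun t : R => F (x + t *: d) - G (x + t *: d)) @ 0^'+ --> F x - G x.
  by apply: cvgB; [exact: dir_deriv_cvg _ _ _ _ Fl|exact: dir_deriv_cvg _ _ _ _ Gl'].
move/cvgr_gt => /(_ 0); rewrite subr_gt0 => /(_ GF).
by apply: filterS => t; rewrite subr_gt0 => GFt; rewrite (max_idPl (ltW GFt)) (max_idPl (ltW GF)).
Qed.

(** With equal values at [x], the difference quotient of the maximum is the maximum of the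
    difference quotients, because [t] is positive. *)
Lemma dir_deriv_max_eq F G x d l l' : F x = G x ->
  dir_deriv F x d l -> dir_deriv G x d l' ->
  dir_deriv (fun y => Num.max (F y) (G y)) x d (Num.max l l').
Proof.
move=> GF Fl Gl'; 
have : (fun t : R => Num.max ((F (x + t *: d) - F x) / t) ((G (x + t *: d) - G x) / t))
    @ 0^'+ --> Num.max l l' by exact: cvg_max.
apply: cvg_trans; apply: near_eq_cvg.
near=> t; have t0 : 0 < t by near: t; exact: nbhs_right_gt.
rewrite -maxr_pMl ?invr_ge0 ?(ltW t0) // -GF maxxx; congr (_ / _).
by rewrite addr_maxl.
Unshelve. all: by end_near. Qed.

Lemma dir_deriv_le_max F G x d c :
  dir_deriv_le F x d c -> dir_deriv_le G x d c ->
  dir_deriv_le (fun y => Num.max (F y) (G y)) x d c.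
Proof.
move=> [l [Fl lc]] [l' [Gl' l'c]]; rewrite /dir_deriv_le.
case: (ltgtP (F x) (G x)) => [FG|GF|FG].
- exists l'; split => //.
  rewrite (_ : (fun y => _) = (fun y => Num.max (G y) (F y))).
    exact: (dir_deriv_max_gt _ _ _ _ _ l).
  by apply/funext => y; rewrite maxC.
- exists l; split => //; exact: (dir_deriv_max_gt _ _ _ _ _ l').
- exists (Num.max l l'); split; first exact: dir_deriv_max_eq.
  by rewrite ge_max lc FG l'c.
Qed.

(** The hypothesis [0 <= c] accounts for the default value 0 of the iterated maximum: the zero
    function has slope [0 <= c - 0]. *)
Lemma dir_deriv_le_bigmax (I : Type) (s : seq I) (F : I -> 'cV[R]_n -> R) x d c :
  0 <= c -> (forall i, dir_deriv_le (F i) x d c) ->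
  dir_deriv_le (fun y => \big[Num.max/0]_(i <- s) F i y) x d c.
Proof.
move=> c0 HF; elim: s => [|i s IHs].
  exists 0; rewrite /dir_deriv big_nil subr0; split => //.
  rewrite (_ : (fun t => _) = cst 0); first exact: cvg_cst.
  by apply/funext => t; rewrite !big_nil subrr mul0r.
rewrite (_ : (fun y => _) = fun y => Num.max (F i y) (\big[Num.max/0]_(j <- s) F j y)).
  exact: dir_deriv_le_max.
by apply/funext => y; rewrite big_cons.
Qed.

Lemma C1_dir_deriv F (G : 'cV[R]_n -> 'cV[R]_n) x d :
  C1_with_grad F G -> dir_deriv F x d (dotv (G x) d).
Proof.
move=> [/(_ x)[dF dFE] _].
have := @diff_derivable _ _ _ F x d dF.
rewrite /derivable -/(derive F x d) deriveE // dFE => /cvg_dnbhs_at_right.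
rewrite /dir_deriv (_ : (fun h => _) = (fun t : R => (F (x + t *: d) - F x) / t)) //.
by apply/funext => t /=; rewrite (addrC x) mulrC.
Qed.

Lemma dir_derivN F x d l : dir_deriv F x d l -> dir_deriv (fun y => - F y) x d (- l).
Proof.
move=> Fl.
have : (fun t : R => - ((F (x + t *: d) - F x) / t)) @ 0^'+ --> - l by exact: cvgN.
by apply: cvg_trans; apply: near_eq_cvg; apply: nearW => t; ring.
Qed.

Lemma dir_deriv_addZ F G x d l l' r : dir_deriv F x d l -> dir_deriv G x d l' ->
  dir_deriv (fun y => F y + r * G y) x d (l + r * l').
Proof.
move=> Fl Gl'.
have : (fun t : R => (F (x + t *: d) - F x) / t + r * ((G (x + t *: d) - G x) / t))
    @ 0^'+ --> l + r * l'.
  by apply: cvgD => //; apply: cvgM => //; exact: cvg_cst.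
rewrite /dir_deriv.
apply: cvg_trans; apply: near_eq_cvg; apply: nearW => t.
by ring.
Qed.

Lemma dir_deriv_lt0_descent F x d l :
  dir_deriv F x d l -> l < 0 -> descent_direction F x d.
Proof.
move=> Fl l0; have /cvgr_lt/(_ 0 l0) := Fl.
rewrite near_withinE => /nbhs_ballP[e /= e0 He].
exists (e / 2); split; first by rewrite divr_gt0.
move=> t /andP[t0 te].
have : (F (x + t *: d) - F x) / t < 0.
  apply: (He t) => //; rewrite -ball_normE /ball_ /= sub0r normrN gtr0_norm //.
  by lra.
by rewrite pmulr_llt0 ?invr_gt0 // subr_lt0.
Qed.

End DirectionalDerivative.

(** * Slope of the merit function along a solution of the quadratic program *)

Section QuadraticProgram.
Context {R : realType} {n p me : nat}.
Variables (fs : R -> 'cV[R]_n -> R) (gs : 'I_p -> R -> 'cV[R]_n -> R)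
  (hs : 'I_me -> R -> 'cV[R]_n -> R).
Variables (Gf : R -> 'cV[R]_n -> 'cV[R]_n) (Gg : 'I_p -> R -> 'cV[R]_n -> 'cV[R]_n)
  (Gh : 'I_me -> R -> 'cV[R]_n -> 'cV[R]_n).
Implicit Types (rho r xi lx c : R) (x d : 'cV[R]_n) (W : 'M[R]_n).

Lemma phi_s_ge0 rho x : 0 <= phi_s gs hs rho x.
Proof. by rewrite /phi_s le_max bigmax_ge_id. Qed.

Lemma g_le_phi_s rho x i : gs i rho x <= phi_s gs hs rho x.
Proof. by rewrite /phi_s le_max (le_bigmax _ (fun i => gs i rho x)). Qed.

Lemma h_le_phi_s rho x j : `|hs j rho x| <= phi_s gs hs rho x.
Proof. by rewrite /phi_s le_max (le_bigmax _ (fun j => `|hs j rho x|)) orbT. Qed.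

Lemma phi_s_le rho x c : 0 <= c -> (forall i, gs i rho x <= c) ->
  (forall j, `|hs j rho x| <= c) -> phi_s gs hs rho x <= c.
Proof. by move=> c0 Hg Hh; rewrite /phi_s ge_max; apply/andP; split; apply: bigmax_le. Qed.

(* The multiplier [lx] of [0 <= xi] vanishes unless [xi = 0], hence the total
   mass of the other multipliers may be replaced by [r]. *)
Lemma qp_kkt_slope_le rho x W r d xi lg lp lm lx :
  qp_kkt gs hs Gf Gg Gh rho x W r d xi lg lp lm lx ->
  dotv (Gf rho x) d + r * (xi - phi_s gs hs rho x) <= - quadf W d.
Proof.
move=> [lg0 [lpm0 [lx0 [stat [rE [cg [ch cx]]]]]]].
have := congr1 (fun u => dotv u d) stat.
rewrite !dotvDl dotv0l !dotv_suml -/(dotv _ _) (dotvC (W *m d)) -quadfE.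
set phi := phi_s gs hs rho x.
have Sg : (\sum_i lg i) * (xi - phi) <= \sum_(i < p) dotv (lg i *: Gg i rho x) d.
  rewrite mulr_suml; apply: ler_sum => i _; rewrite dotvZl.
  have := cg i; have := lg0 i; have := g_le_phi_s rho x i; rewrite -/phi; nra.
have Sh : (\sum_j (lp j + lm j)) * (xi - phi)
    <= \sum_(j < me) dotv ((lp j - lm j) *: Gh j rho x) d.
  rewrite mulr_suml; apply: ler_sum => j _; rewrite dotvZl.
  have [c1 c2] := ch j; have [p0 m0] := lpm0 j.
  have := h_le_phi_s rho x j; rewrite -/phi ler_norml => /andP[h1 h2].
  have : 0 <= lp j * (phi - hs j rho x) by apply: mulr_ge0 => //; lra.
  have : 0 <= lm j * (phi + hs j rho x) by apply: mulr_ge0 => //; lra.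
  lra.
have phi0 : 0 <= phi by exact: phi_s_ge0.
have := mulr_ge0 lx0 phi0.
rewrite rE; move: Sg Sh.
move: (\sum_i _) (\sum_j (_ + _)) (\sum_i dotv _ _) (\sum_j dotv _ _) => a b c e.
nra.
Qed.

Lemma qp_kkt_r_ge0 rho x W r d xi lg lp lm lx :
  qp_kkt gs hs Gf Gg Gh rho x W r d xi lg lp lm lx -> 0 <= r.
Proof.
move=> [lg0 [lpm0 [lx0 [_ [-> _]]]]]; rewrite !addr_ge0 ?sumr_ge0 // => j _.
by have [? ?] := lpm0 j; rewrite addr_ge0.
Qed.

Hypotheses (Cf : forall rho, 0 < rho -> C1_with_grad (fs rho) (Gf rho))
  (Cg : forall i rho, 0 < rho -> C1_with_grad (gs i rho) (Gg i rho))
  (Ch : forall j rho, 0 < rho -> C1_with_grad (hs j rho) (Gh j rho)).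

(** A linearized constraint bounded by [xi] says exactly that the slope of that constraint is at
    most [xi] minus its value, which is the form stable under maxima. *)
Lemma phi_s_dir_deriv_le rho x d xi : 0 < rho ->
  qp_feasible gs hs Gg Gh rho x d xi -> dir_deriv_le (phi_s gs hs rho) x d xi.
Proof.
move=> rho0 [fg [fh xi0]].
apply: dir_deriv_le_max; apply: dir_deriv_le_bigmax => // i.
  exists (dotv (Gg i rho x) d); split; first exact/C1_dir_deriv/Cg.
  by rewrite lerBrDl.
(* Writing the absolute value as a maximum matches the two linearized inequalities attached to an
   equality constraint. *)
rewrite (_ : (fun y => _) = fun y => Num.max (hs i rho y) (- hs i rho y)); last first.
  apply/funext => y; case: (lerP 0 (hs i rho y)) => h0.
    by rewrite ger0_norm // max_l //; lra.
  by rewrite ltr0_norm // max_r //; lra.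
have dh := C1_dir_deriv _ _ x d (Ch i _ rho0).
have [h1 h2] := fh i.
apply: dir_deriv_le_max; first by exists (dotv (Gh i rho x) d); rewrite lerBrDl.
exists (- dotv (Gh i rho x) d); split; first exact: dir_derivN.
by rewrite lerBrDl.
Qed.

Lemma theta_dir_deriv_le rho x W r d xi lg lp lm lx : 0 < rho ->
  qp_feasible gs hs Gg Gh rho x d xi ->
  qp_kkt gs hs Gf Gg Gh rho x W r d xi lg lp lm lx ->
  exists l, dir_deriv (theta fs gs hs rho r) x d l /\ l <= - quadf W d.
Proof.
move=> rho0 feas kkt.
have [l [phil lxi]] := phi_s_dir_deriv_le _ _ _ _ rho0 feas.
exists (dotv (Gf rho x) d + r * l); split.
  exact: dir_deriv_addZ (C1_dir_deriv _ _ _ _ (Cf _ rho0)) phil.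
apply: le_trans (qp_kkt_slope_le _ _ _ _ _ _ _ _ _ _ kkt).
by rewrite lerD2l ler_wpM2l // (qp_kkt_r_ge0 _ _ _ _ _ _ _ _ _ _ kkt).
Qed.

End QuadraticProgram.

(** * First-order expansion, uniform near a point *)

Section Linearization.
Context {R : realType} {n : nat}.
Implicit Types (F : 'cV[R]_n -> R) (G : 'cV[R]_n -> 'cV[R]_n) (x d : 'cV[R]_n).

Lemma C1_is_derive_line F G x d (s : R) : C1_with_grad F G ->
  is_derive s 1 (fun t : R => F (x + t *: d)) (dotv (G (x + s *: d)) d).
Proof.
move=> [/(_ (x + s *: d))[dF dFE] _].
have E : (fun h : R => h^-1 *: (((fun t : R => F (x + t *: d)) \o shift s) (h *: (1 : R))
      - F (x + s *: d)))
    = (fun h : R => h^-1 *: ((F \o shift (x + s *: d)) (h *: d) - F (x + s *: d))).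
  apply/funext => h /=; congr (_ *: (F _ - _)).
  by rewrite [h *: _]mulr1 scalerDl addrCA.
split; first by rewrite /derivable E; exact: diff_derivable.
by rewrite /derive E -/(derive F (x + s *: d) d) deriveE // dFE.
Qed.

Lemma C1_continuous F G : C1_with_grad F G -> continuous F.
Proof. by move=> [dF _] x; have [/differentiable_continuous] := dF x. Qed.

Lemma near_enorm (P : set 'cV[R]_n) x : (\forall y \near x, P y) ->
  \forall del \near (0 : R)^'+, forall y, enorm (y - x) < del -> P y.
Proof.
move=> /nbhs_enormP[del0 d0 HP]; near=> del => y yx; apply: HP.
by apply: lt_le_trans yx _; near: del; exact: nbhs_right_le.
Unshelve. all: by end_near. Qed.

(** By the mean value theorem the error is [t] times the change of the gradient paired with [d], and
    continuity of [G] at [x0] alone controls that change for all nearby base points at once. *)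
Lemma C1_linearization F G x0 (D eps : R) : C1_with_grad F G -> 0 <= D -> 0 < eps ->
  \forall del \near (0 : R)^'+, forall x d t,
    enorm (x - x0) < del -> enorm d <= D -> 0 < t <= del ->
    `|F (x + t *: d) - F x - t * dotv (G x) d| <= t * eps.
Proof.
move=> CF D0 e0.
(* Both gradients lie within this distance of [G x0], so their difference times [D] is at most
   [eps]; the added 1 covers [D = 0]. *)
have e1 : 0 < eps / (2 * (D + 1)) by rewrite divr_gt0 //; lra.
have /cvg_enormP/(_ _ e1)/nbhs_enormP[del0 d0 HG] := CF.2 x0.
(* Below this radius, [del + del * D <= del0] keeps the intermediate point in the ball where [G] is
   controlled. *)
have d1 : 0 < del0 / (D + 1) by rewrite divr_gt0 //; lra.
near=> del => x d t xx0 dD /andP[t0 tdel].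
have delD : del * (D + 1) <= del0.
  by rewrite -ler_pdivlMr ?ltr_wpDl //; near: del; exact: nbhs_right_le.
have [c /andP[/= c0 ct] Ec] := MVT_segment (ltW t0)
  (fun s _ => C1_is_derive_line F G x d s CF)
  (derivable_within_continuous (fun s _ =>
     @ex_derive _ _ _ _ _ _ _ (C1_is_derive_line F G x d s CF))).
rewrite scale0r addr0 subr0 in Ec.
rewrite Ec mulrC -mulrBr -dotvNl -dotvDl normrM gtr0_norm // ler_wpM2l ?(ltW t0) //.
rewrite bnd_simp in c0; rewrite bnd_simp in ct.
have near1 y : enorm (y - x0) < del0 -> enorm (G y - G x0) < eps / (2 * (D + 1)) := HG y.
have dn := enorm_ge0 d.
have cd : c * enorm d <= del * D by apply: ler_pM => //; exact: le_trans ct tdel.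
have H1 : enorm (G (x + c *: d) - G x0) < eps / (2 * (D + 1)).
  apply: near1; apply: le_lt_trans (enorm_dist_trans x _ _) _.
  by rewrite (addrAC x) subrr add0r enormZ ger0_norm //; lra.
have H2 : enorm (G x - G x0) < eps / (2 * (D + 1)).
  by apply: near1; have := mulr_ge0 (ltW (lt_le_trans t0 tdel)) D0; lra.
apply: le_trans (normr_dotv_le _ _) _.
have H3 : enorm (G (x + c *: d) - G x) <= eps / (D + 1).
  apply: le_trans (enorm_dist_trans (G x0) _ _) _; rewrite (enormBC (G x0)).
  have -> : eps / (D + 1) = eps / (2 * (D + 1)) + eps / (2 * (D + 1)) by field; lra.
  by rewrite ltW // ltrD.
apply: le_trans (_ : eps / (D + 1) * D <= _).
  by apply: ler_pM => //; exact: enorm_ge0.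
rewrite mulrAC ler_pdivrMr ?ltr_wpDl // ler_wpM2l ?(ltW e0) //; lra.
Unshelve. all: by end_near. Qed.

Lemma bigmax_continuous (I : Type) (s : seq I) (F : I -> 'cV[R]_n -> R) :
  (forall i, continuous (F i)) -> continuous (fun y => \big[Num.max/0]_(i <- s) F i y).
Proof.
move=> cF; elim: s => [|i s IHs] x.
  have -> : (fun y => \big[Num.max/0]_(i <- [::]) F i y) = cst 0.
    by apply/funext => y; rewrite big_nil.
  exact: cst_continuous.
have -> : (fun y => \big[Num.max/0]_(j <- i :: s) F j y)
    = fun y => Num.max (F i y) (\big[Num.max/0]_(j <- s) F j y).
  by apply/funext => y; rewrite big_cons.
exact: cvg_max (cF i x) (IHs x).
Qed.

End Linearization.

(** * Subsequence extraction and geometric growth *)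

Section Sequences.
Context {R : realType}.

Lemma increasing_seq_ge_id (phi : nat -> nat) : increasing_seq phi ->
  forall k, (k <= phi k)%N.
Proof.
move=> /increasing_seqP phiS; elim=> [//|k IHk].
exact: leq_ltn_trans IHk (phiS k).
Qed.

Lemma ge_id_cvg (phi : nat -> nat) : (forall k, (k <= phi k)%N) -> phi @ \oo --> \oo.
Proof.
move=> phik P [N _ HN]; exists N => // k /= Nk; apply: HN => /=.
exact: leq_trans Nk (phik k).
Qed.

(** Indices are treated one after another, each time refining the subsequence already found; earlier
    limits survive the refinement. *)
Lemma bolzano_weierstrass_fin (I : finType) (u : nat -> I -> R) (B : I -> R) :
  (forall k i, `|u k i| <= B i) ->
  exists2 phi : nat -> nat, increasing_seq phi &
    exists l : I -> R, forall i, (fun k => u (phi k) i) @ \oo --> l i.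
Proof.
move=> uB.
suff [phi iphi cphi] : exists2 phi : nat -> nat, increasing_seq phi &
    forall i, i \in enum I -> cvgn (fun k => u (phi k) i).
  exists phi => //; exists (fun i => limn (fun k => u (phi k) i)) => i.
  by apply: cphi; rewrite mem_enum.
elim: (enum I) => [|i s [phi iphi cphi]]; first by exists id.
have [|psi ipsi cpsi] := @bolzano_weierstrass R (fun k => u (phi k) i).
  exists (B i); split; first exact: num_real.
  by move=> M BM k _; exact: le_trans (uB _ _) (ltW BM).
exists (phi \o psi) => [a b|j]; first by rewrite /= iphi -leEnat ipsi.
rewrite inE => /orP[/eqP -> //|js].
apply/cvg_ex; have /cvg_ex[l Hl] := cphi j js; exists l.
have psioo := ge_id_cvg _ (increasing_seq_ge_id _ ipsi).
exact: (cvg_comp psi (fun k => u (phi k) j) psioo Hl).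
Qed.

Lemma bolzano_weierstrass_cV n (z : nat -> 'cV[R]_n) (B : R) :
  (forall k, enorm (z k) <= B) ->
  exists2 phi : nat -> nat, increasing_seq phi &
    exists l : 'cV[R]_n, (fun k => z (phi k)) @ \oo --> l.
Proof.
move=> zB.
have [|phi iphi [l Hl]] := bolzano_weierstrass_fin _ (fun k i => z k i 0) (fun=> B).
  by move=> k i; apply: le_trans (coord_le_enorm _ _) (zB k).
exists phi => //; exists (\col_i l i); apply: cvg_coord => i; rewrite mxE; exact: Hl.
Qed.

(** Serves both the smoothing parameter [rho] and the penalty parameter [r], with [b] marking the
    iterations that enlarge them. *)
Lemma geometric_growth (u : nat -> R) (s : R) (b : nat -> bool) :
  0 < u 0%N -> 1 < s -> (forall k, u k.+1 = if b k then s * u k else u k) ->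
  (forall k, 0 < u k) /\
  ((forall N, exists k, (N <= k)%N /\ b k) -> u @ \oo --> +oo).
Proof.
move=> u0 s1 uS.
have up k : 0 < u k.
  by elim: k => [//|k IHk]; rewrite uS; case: (b k) => //; rewrite mulr_gt0 //; lra.
split => // binf.
have umono : {homo u : i j / (i <= j)%N >-> i <= j}.
  apply: homo_leq => [//|? ? ?|k]; first exact: le_trans.
  by rewrite uS; case: (b k) => //; rewrite ler_peMl // ltW.
(* A linear lower bound after [j] enlargements suffices: each one adds at least [(s - 1) * u 0],
   since [u] never drops below [u 0]. *)
have H j : exists N, u 0%N + j%:R * ((s - 1) * u 0%N) <= u N.
  elim: j => [|j [N HN]]; first by exists 0%N; rewrite mul0r addr0.
  have [k [Nk bk]] := binf N; exists k.+1; rewrite uS bk -natr1.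
  have := umono _ _ Nk; have := umono _ _ (leq0n k).
  have : 0 < s - 1 by lra.
  move: (u k) (u N) HN (up k) => a c; nra.
apply/cvgryPge => A.
have c0 : 0 < (s - 1) * u 0%N by rewrite mulr_gt0 //; lra.
have [N HN] := H (Num.truncn (`|A| / ((s - 1) * u 0%N))).+1.
exists N => // k /= Nk; apply: le_trans (umono _ _ Nk); apply: le_trans HN.
have := @truncnS_gt R (`|A| / ((s - 1) * u 0%N)).
rewrite ltr_pdivrMr // => HA; have := ler_norm A; have := ltW u0; lra.
Qed.

End Sequences.

(** * The Armijo line search with frozen parameters *)

Section LineSearch.
Context {R : realType} {n p me : nat}.
Variables (fs : R -> 'cV[R]_n -> R) (gs : 'I_p -> R -> 'cV[R]_n -> R)
  (hs : 'I_me -> R -> 'cV[R]_n -> R).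
Variables (Gf : R -> 'cV[R]_n -> 'cV[R]_n) (Gg : 'I_p -> R -> 'cV[R]_n -> 'cV[R]_n)
  (Gh : 'I_me -> R -> 'cV[R]_n -> 'cV[R]_n).
Implicit Types (rho r xi lx c : R) (x d : 'cV[R]_n) (W : 'M[R]_n).

(* The linearized constraints at step [t] are convex combinations of their
   values at [0], bounded by [phi], and at the full step, bounded by [xi]. *)
Lemma theta_step_le rho x W r d xi lg lp lm lx (t e : R) :
  qp_feasible gs hs Gg Gh rho x d xi ->
  qp_kkt gs hs Gf Gg Gh rho x W r d xi lg lp lm lx ->
  0 < t <= 1 -> 0 <= e ->
  `|fs rho (x + t *: d) - fs rho x - t * dotv (Gf rho x) d| <= t * e ->
  (forall i, `|gs i rho (x + t *: d) - gs i rho x - t * dotv (Gg i rho x) d| <= t * e) ->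
  (forall j, `|hs j rho (x + t *: d) - hs j rho x - t * dotv (Gh j rho x) d| <= t * e) ->
  theta fs gs hs rho r (x + t *: d) - theta fs gs hs rho r x
    <= t * (e * (1 + r) - quadf W d).
Proof.
move=> [fg [fh xi0]] kkt /andP[t0 t1] e0 Lf Lg Lh.
have r0 := qp_kkt_r_ge0 _ _ _ _ _ _ _ _ _ _ _ _ _ _ _ kkt.
have slope := qp_kkt_slope_le _ _ _ _ _ _ _ _ _ _ _ _ _ _ _ kkt.
have phi0 := phi_s_ge0 gs hs rho x; rewrite /theta.
have gphi := g_le_phi_s gs hs rho x; have hphi := h_le_phi_s gs hs rho x.
move: slope phi0 gphi hphi; set phi := phi_s gs hs rho x => slope phi0 gphi hphi.
have te : 0 <= t * e by rewrite mulr_ge0 // ltW.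
have t1' : 0 <= 1 - t by rewrite subr_ge0.
have phit : phi_s gs hs rho (x + t *: d) <= (1 - t) * phi + t * xi + t * e.
  apply: phi_s_le => [|i|j].
  - by rewrite !addr_ge0 // mulr_ge0 // ltW.
  - have := Lg i; rewrite ler_norml => /andP[_ L].
    have A1 := ler_wpM2l (ltW t0) (fg i); have A2 := ler_wpM2l t1' (gphi i).
    lra.
  - have := Lh j; rewrite !ler_norml => /andP[L1 L2].
    have := hphi j; rewrite ler_norml => /andP[h1 h2]; have [f1 f2] := fh j.
    have A1 := ler_wpM2l (ltW t0) f1; have A2 := ler_wpM2l t1' h2.
    have A3 := ler_wpM2l (ltW t0) f2; have A4 := ler_wpM2l t1' h1.
    by apply/andP; split; lra.
have A1 := ler_wpM2l r0 phit; have A2 := ler_wpM2l (ltW t0) slope.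
move: Lf; rewrite ler_norml => /andP[_ L].
lra.
Qed.

(** Pair the stationarity equation with [d], apply Cauchy-Schwarz, and cancel one factor [enorm d].
    Bounded multipliers and gradients then bound the search directions. *)
Lemma qp_kkt_step_bound rho x W r d xi lg lp lm lx (m : R) :
  qp_kkt gs hs Gf Gg Gh rho x W r d xi lg lp lm lx ->
  m * enorm d ^+ 2 <= quadf W d ->
  m * enorm d <= enorm (Gf rho x) + \sum_i `|lg i| * enorm (Gg i rho x)
     + \sum_j `|lp j - lm j| * enorm (Gh j rho x).
Proof.
move=> [_ [_ [_ [stat _]]]] Hm.
have [->|d0] := eqVneq d 0.
  rewrite enorm0 mulr0 !addr_ge0 ?enorm_ge0 // sumr_ge0 // => i _;
  by rewrite mulr_ge0 // enorm_ge0.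
rewrite -(ler_pM2r (enorm_gt0 _ d0)) -mulrA -expr2; apply: le_trans Hm _.
have -> : quadf W d = - dotv (Gf rho x + \sum_(i < p) lg i *: Gg i rho x
    + \sum_(j < me) (lp j - lm j) *: Gh j rho x) d.
  have := congr1 (fun u => dotv u d) stat.
  by rewrite quadfE dotv0l !dotvDl (dotvC (W *m d)) => E; lra.
rewrite -dotvNl; apply: le_trans (cauchy_schwarz _ _) _.
rewrite enormN ler_wpM2r ?enorm_ge0 //.
apply: le_trans (enormD _ _) (lerD (le_trans (enormD _ _) (lerD (lexx _) _)) _);
  apply: le_trans (enorm_sum _ _) _; apply: ler_sum => i _; by rewrite enormZ.
Qed.

Hypotheses (Cf : forall rho, 0 < rho -> C1_with_grad (fs rho) (Gf rho))
  (Cg : forall i rho, 0 < rho -> C1_with_grad (gs i rho) (Gg i rho))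
  (Ch : forall j rho, 0 < rho -> C1_with_grad (hs j rho) (Gh j rho)).

Lemma theta_continuous rho r : 0 < rho -> continuous (theta fs gs hs rho r).
Proof.
move=> rho0 y.
have cphi : {for y, continuous (phi_s gs hs rho)}.
  have cg := bigmax_continuous _ (index_enum 'I_p) (fun i => gs i rho)
    (fun i => C1_continuous _ _ (Cg i _ rho0)).
  have ch : continuous (fun z => \big[Num.max/0]_(j < me) `|hs j rho z|).
    apply: (bigmax_continuous _ _ (fun j z => `|hs j rho z|)) => j z.
    exact: cvg_norm (C1_continuous _ _ (Ch j _ rho0) z).
  exact: cvg_max (cg y) (ch y).
exact: cvgD (C1_continuous _ _ (Cf _ rho0) y) (cvgM (cvg_cst r) cphi).
Qed.

Lemma near_bounded_grad (F : 'cV[R]_n -> R) (G : 'cV[R]_n -> 'cV[R]_n) x0 :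
  C1_with_grad F G -> \forall y \near x0, enorm (G y) <= enorm (G x0) + 1.
Proof.
move=> [_ /(_ x0)/cvg_enormP/(_ 1 ltr01)]; apply: filterS => y H.
by have := ler_enormB (G y) (G x0); lra.
Qed.

(* If all steps were at least [c] with frozen penalty parameters, then near an
   accumulation point of the iterates every small trial step passes the
   Armijo test, while the convergence of the merit values forces the accepted
   steps to be small. *)
Lemma armijo_steps_not_bounded_below rho r (beta sigma1 : R) (x d : nat -> 'cV[R]_n)
    (xi : nat -> R) lg lp lm (lx : nat -> R) (W : nat -> 'M[R]_n) (m B Bl c : R) :
  0 < rho -> 0 < beta < 1 -> 0 < sigma1 < 1 -> 0 < m -> 0 < c -> 0 <= Bl ->
  (forall k (v : 'cV[R]_n), m * enorm v ^+ 2 <= quadf (W k) v) ->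
  (forall k, enorm (x k) <= B) ->
  (forall k, (forall i, `|lg k i| <= Bl) /\ (forall j, `|lp k j| <= Bl /\ `|lm k j| <= Bl)) ->
  (forall k, c <= enorm (d k)) ->
  (forall k, qp_feasible gs hs Gg Gh rho (x k) (d k) (xi k)) ->
  (forall k, qp_kkt gs hs Gf Gg Gh rho (x k) (W k) r (d k) (xi k)
     (lg k) (lp k) (lm k) (lx k)) ->
  (forall k, let armijo (a : R) :=
       theta fs gs hs rho r (x k + a *: d k) - theta fs gs hs rho r (x k)
         <= - sigma1 * a * quadf (W k) (d k) in
     exists l : nat, [/\ x k.+1 = x k + beta ^+ l *: d k, armijo (beta ^+ l) &
                forall l' : nat, (l' < l)%N -> ~ armijo (beta ^+ l')]) ->
  False.
Proof.
move=> rho0 /andP[b0 b1] /andP[s0 s1] m0 c0 Bl0 HW HxB HlB Hc feas kkt step.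
have r0 := qp_kkt_r_ge0 _ _ _ _ _ _ _ _ _ _ _ _ _ _ _ (kkt 0%N).
have [phi iphi [xb xphi]] := bolzano_weierstrass_cV _ _ _ HxB.
(* Near [xb] gradients exceed their values at [xb] by at most 1 in norm, and [lp - lm] is bounded by
   [2 * Bl]; hence [D] below bounds the directions there. *)
pose C := (enorm (Gf rho xb) + 1) + \sum_i Bl * (enorm (Gg i rho xb) + 1)
   + \sum_j (2 * Bl) * (enorm (Gh j rho xb) + 1).
have C0 : 0 <= C.
  by rewrite !addr_ge0 ?enorm_ge0 // sumr_ge0 // => i _;
    rewrite ?mulr_ge0 ?addr_ge0 ?enorm_ge0.
pose D := C / m; have D0 : 0 <= D by rewrite divr_ge0 // ltW.
pose q0 := m * c ^+ 2; have q00 : 0 < q0 by rewrite mulr_gt0 // exprn_gt0.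
(* Chosen so that the linearization error [e * (1 + r)] uses up no more than the slack between the
   full decrease and its fraction [sigma1]. *)
pose e := (1 - sigma1) * q0 / (1 + r).
have r1 : 0 < 1 + r by rewrite ltr_wpDr.
have e0 : 0 < e by rewrite divr_gt0 // mulr_gt0 // subr_gt0.
have qk k : q0 <= quadf (W k) (d k).
  apply: le_trans (HW k (d k)); rewrite ler_wpM2l ?(ltW m0) //.
  by rewrite ler_pXn2r ?nnegrE ?(ltW c0) ?enorm_ge0.
near (0 : R)^'+ => del.
have del0 : 0 < del by near: del; exact: nbhs_right_gt.
have del1 : del <= 1 by near: del; exact: nbhs_right_le.
have Nf y : enorm (y - xb) < del -> enorm (Gf rho y) <= enorm (Gf rho xb) + 1.
  by move: y; near: del; exact/near_enorm/near_bounded_grad/Cf.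
have Ng i y : enorm (y - xb) < del -> enorm (Gg i rho y) <= enorm (Gg i rho xb) + 1.
  move: i y; near: del; apply: filter_forall => i.
  exact/near_enorm/near_bounded_grad/Cg.
have Nh j y : enorm (y - xb) < del -> enorm (Gh j rho y) <= enorm (Gh j rho xb) + 1.
  move: j y; near: del; apply: filter_forall => j.
  exact/near_enorm/near_bounded_grad/Ch.
have Lf z v t : enorm (z - xb) < del -> enorm v <= D -> 0 < t <= del ->
    `|fs rho (z + t *: v) - fs rho z - t * dotv (Gf rho z) v| <= t * e.
  by move: z v t; near: del; exact: C1_linearization (Cf _ rho0) D0 e0.
have Lg i z v t : enorm (z - xb) < del -> enorm v <= D -> 0 < t <= del ->
    `|gs i rho (z + t *: v) - gs i rho z - t * dotv (Gg i rho z) v| <= t * e.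
  move: i z v t; near: del; apply: filter_forall => i.
  exact: C1_linearization (Cg i _ rho0) D0 e0.
have Lh j z v t : enorm (z - xb) < del -> enorm v <= D -> 0 < t <= del ->
    `|hs j rho (z + t *: v) - hs j rho z - t * dotv (Gh j rho z) v| <= t * e.
  move: j z v t; near: del; apply: filter_forall => j.
  exact: C1_linearization (Ch j _ rho0) D0 e0.
have armijo k (t : R) : enorm (x k - xb) < del -> 0 < t <= del ->
    theta fs gs hs rho r (x k + t *: d k) - theta fs gs hs rho r (x k)
      <= - sigma1 * t * quadf (W k) (d k).
  move=> xk /andP[t0 td].
  have dD : enorm (d k) <= D.
    rewrite /D ler_pdivlMr // mulrC.
    apply: le_trans (qp_kkt_step_bound _ _ _ _ _ _ _ _ _ _ _ (kkt k) (HW k (d k))) _.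
    have [Hg Hh] := HlB k.
    rewrite /C !lerD ?Nf //; apply: ler_sum => i _; apply: ler_pM => //;
      rewrite ?enorm_ge0 ?Ng ?Nh //.
    have [h1 h2] := Hh i; apply: le_trans (ler_normB _ _) _; lra.
  have tt : 0 < t <= del by rewrite t0.
  have t1 : 0 < t <= 1 by rewrite t0 (le_trans td).
  have := theta_step_le _ _ _ _ _ _ _ _ _ _ _ _ (feas k) (kkt k) t1 (ltW e0)
    (Lf _ _ _ xk dD tt) (fun i => Lg i _ _ _ xk dD tt) (fun j => Lh j _ _ _ xk dD tt).
  move=> H; apply: le_trans H _.
  rewrite /e divfK ?gt_eqF //.
  have s1' : 0 <= 1 - sigma1 by rewrite subr_ge0 ltW.
  have := ler_wpM2l (ltW t0) (ler_wpM2l s1' (qk k)).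
  lra.
pose th k := theta fs gs hs rho r (x k).
(* If the accepted step [a] is not 1, the previous trial [a / beta] was rejected; near [xb] this is
   possible only when [a / beta] exceeds [del]. *)
have thS k : exists2 a : R, 0 < a & th k.+1 <= th k - sigma1 * a * q0 /\
    (a = 1 \/ (del < a / beta \/ ~ enorm (x k - xb) < del)).
  have [l [xS al nal]] := step k; exists (beta ^+ l); first exact: exprn_gt0.
  split.
    have sb : 0 <= sigma1 * beta ^+ l.
      by rewrite mulr_ge0 ?exprn_ge0 ?(ltW s0) ?(ltW b0).
    by rewrite /th xS; have := ler_wpM2l sb (qk k); lra.
  case: l al nal xS => [|l] al nal _; first by left.
  right; rewrite exprS mulrAC mulfV ?gt_eqF // mul1r.
  case: (pselect (enorm (x k - xb) < del)) => [xk|]; last by right.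
  left; rewrite ltNge; apply/negP => bd; apply: (nal l) => //.
  by apply: armijo => //; rewrite exprn_gt0.
have thmono : {homo th : i j / (i <= j)%N >-> j <= i}.
  apply: homo_leq => [//|u v w a b|k]; first exact: le_trans b a.
  have [a a0 [H _]] := thS k; apply: le_trans H _.
  by rewrite gerBl !mulr_ge0 // ltW.
(* Half of the decrease guaranteed by one iteration started near [xb]. Two visits with merit values
   within [e1] of the value at [xb] leave no room for that decrease in between. *)
pose e1 := sigma1 * q0 * Num.min 1 (del * beta) / 2.
have e10 : 0 < e1.
  by rewrite !mulr_gt0 // ?invr_gt0 // lt_min ltr01 mulr_gt0.
have near_k N : exists k, [/\ (N <= k)%N, enorm (x k - xb) < del
    & `|th k - theta fs gs hs rho r xb| < e1].
  have /nbhs_enormP[del' d'0 Hd'] : \forall y \near xb,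
      `|theta fs gs hs rho r xb - theta fs gs hs rho r y| < e1.
    by have /cvgrPdist_lt := theta_continuous rho r rho0 xb; apply.
  have m1 : 0 < Num.min del del' by rewrite lt_min del0.
  have /cvg_enormP/(_ _ m1)[N' _ HN'] := xphi.
  exists (phi (maxn N N')); split.
  - exact: leq_trans (leq_maxl _ _) (increasing_seq_ge_id _ iphi _).
  - have /= := HN' (maxn N N') (leq_maxr _ _); rewrite lt_min => /andP[]//.
  - rewrite distrC; apply: Hd'.
    by have /= := HN' (maxn N N') (leq_maxr _ _); rewrite lt_min => /andP[].
have [k [_ xk tk]] := near_k 0%N.
have [k' [kk' _ tk']] := near_k k.+1.
have [a a0 [th1 ha]] := thS k.
have th2 := thmono _ _ kk'.
have amin : Num.min 1 (del * beta) <= a.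
  rewrite ge_min; case: ha => [->|[ha|//]]; first by rewrite lexx.
  by rewrite -ler_pdivlMr // (ltW ha) orbT.
move: tk tk'; rewrite !ltr_norml => /andP[u1 u2] /andP[v1 v2].
have sq0 : 0 <= sigma1 * q0 by rewrite mulr_ge0 // ltW.
have := ler_wpM2l sq0 amin.
move: v1 u2 th1 th2; rewrite /e1; lra.
Unshelve. all: by end_near. Qed.

End LineSearch.

(** * Local boundedness of the smoothed gradients *)

Section GradientBound.
Context {R : realType} {n : nat}.
Implicit Types (F : 'cV[R]_n -> R) (x v z : 'cV[R]_n).

(** Test the subgradient in its own direction [v]: difference quotients come arbitrarily close to
    the squared norm of [v] from below, or exceed it, yet are at most [L * enorm v]. *)
Lemma clarke_grad_enorm_le F x v (L del : R) : 0 < del ->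
  (forall y z, enorm (y - x) < del -> enorm (z - x) < del ->
     `|F y - F z| <= L * enorm (y - z)) ->
  clarke_grad F x v -> enorm v ^+ 2 <= L * enorm v.
Proof.
move=> del0 HL Hv; apply/ler_addgt0Pr => eps e0.
have v0 := enorm_ge0 v.
have v1 : 0 < 2 * (enorm v + 1) by lra.
(* The first entry puts [y] within [del / 2] of [x], the second keeps the displacement [t *: v]
   below [del / 2]. *)
have m0 : 0 < Num.min (del / 2) (del / (2 * (enorm v + 1))).
  by rewrite lt_min !divr_gt0.
have [y [t [yx [/andP[t0 tm]]]]] := Hv v eps _ e0 m0.
move: yx tm; rewrite !lt_min => /andP[y1 _] /andP[_].
rewrite ltr_pdivlMr // => t1; rewrite -sqr_enorm ltr_pdivlMr // => H.
have y2 : enorm (y - x) < del by lra.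
have y3 : enorm (y + t *: v - x) < del.
  rewrite (addrAC y); apply: le_lt_trans (enormD _ _) _.
  by rewrite enormZ (gtr0_norm t0); lra.
have := HL _ _ y3 y2.
rewrite (addrAC y) subrr add0r enormZ (gtr0_norm t0) ler_norml => /andP[_ H'].
by rewrite -(ler_pM2l t0); nra.
Qed.

Lemma trmx_continuous : continuous (@trmx R 1 n).
Proof.
move=> u; apply: (@cvg_coord R n _ (nbhs u) _ (@trmx R 1 n) u^T) => i; rewrite mxE.
have -> : (fun k : 'rV[R]_n => k^T i 0) = (fun k : 'rV[R]_n => k 0 i).
  by apply/funext => k; rewrite mxE.
exact: coord_continuous.
Qed.

Lemma enorm_sub_continuous x : continuous (fun y : 'cV[R]_n => enorm (y - x)).
Proof.
move=> y; apply: (@cvg_enorm R n _ (nbhs y) _ (fun y => y - x) (y - x)).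
exact: cvgB cvg_id (cvg_cst x).
Qed.

(** The ball is the image under transposition of a closed bounded set of row vectors. *)
Lemma enorm_ball_compact x (del : R) : compact [set y | enorm (y - x) <= del].
Proof.
pose A := [set u : 'rV[R]_n | enorm (u^T - x) <= del].
have -> : [set y | enorm (y - x) <= del] = trmx @` A.
  apply/seteqP; split => [y yx|_ [u uA <-]//].
  by exists y^T; rewrite /A /= trmxK.
apply: continuous_compact.
  by apply: continuous_subspaceT => u; exact: trmx_continuous.
apply: bounded_closed_compact.
  exists (enorm x + del); split; first exact: num_real.
  move=> M HM u uA; apply: le_trans (ltW HM).
  apply: (@le_trans _ _ (enorm u^T)).
    rewrite [leLHS]/Num.Def.normr /= mx_normrE; apply: bigmax_le => [|[i j] _] /=.
      exact: enorm_ge0.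
    by rewrite ord1; have := coord_le_enorm u^T j; rewrite mxE.
  have := ler_enormB u^T x; move: uA; rewrite /A /=; lra.
apply: (@closed_comp _ _ (fun u : 'rV[R]_n => enorm (u^T - x)) [set t | t <= del]).
  move=> u _.
  exact: (continuous_comp (trmx_continuous u) (enorm_sub_continuous x u^T)).
exact: closed_le.
Qed.

Lemma dir_deriv_sqr_enorm x z v :
  dir_deriv (fun y => enorm (y - x) ^+ 2) z v (2 * dotv (z - x) v).
Proof.
have : (fun t : R => 2 * dotv (z - x) v + t * enorm v ^+ 2) @ 0^'+ -->
    2 * dotv (z - x) v + 0 * enorm v ^+ 2.
  apply: cvgD; first exact: cvg_cst.
  by apply: cvgM; [apply: cvg_at_right_filter; exact: cvg_id|exact: cvg_cst].
rewrite mul0r addr0 /dir_deriv; apply: cvg_trans; apply: near_eq_cvg.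
near=> t; have t0 : 0 < t by near: t; exact: nbhs_right_gt.
rewrite (addrAC z); move: (z - x) => w.
rewrite !sqr_enorm dotvDl !dotvDr !dotvZl !dotvZr (dotvC v).
by field; rewrite gt_eqF.
Unshelve. all: by end_near. Qed.

(** Were the gradient [w] of the penalized function nonzero at [z], then [- w] would be a descent
    direction, and a short step along it stays in the ball. *)
Lemma interior_min_grad F (G : 'cV[R]_n -> 'cV[R]_n) x z (C del : R) :
  C1_with_grad F G -> enorm (z - x) < del ->
  (forall y, enorm (y - x) <= del ->
     F z + C * enorm (z - x) ^+ 2 <= F y + C * enorm (y - x) ^+ 2) ->
  G z = - ((2 * C) *: (z - x)).
Proof.
move=> CF zdel zmin; apply/eqP; rewrite -subr_eq0 opprK; apply/eqP.
set w := G z + _; apply: contrapT => /eqP w0.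
have dd := dir_deriv_addZ _ _ _ _ _ _ C (C1_dir_deriv _ _ z (- w) CF)
  (dir_deriv_sqr_enorm x z (- w)).
have l0 : dotv (G z) (- w) + C * (2 * dotv (z - x) (- w)) < 0.
  have -> : dotv (G z) (- w) + C * (2 * dotv (z - x) (- w)) = - enorm w ^+ 2.
    by rewrite mulrA (mulrC C) -dotvZl -dotvDl dotvNr sqr_enorm.
  by rewrite oppr_lt0 exprn_gt0 // enorm_gt0.
have [tau [tau0 Htau]] := dir_deriv_lt0_descent _ _ _ _ dd l0.
have wp := enorm_gt0 _ w0.
pose t := Num.min tau ((del - enorm (z - x)) / enorm w).
have t0 : 0 < t by rewrite lt_min tau0 divr_gt0 // subr_gt0.
have tt : 0 < t <= tau by rewrite t0 ge_min lexx.
have := Htau _ tt; rewrite ltNge zmin // (addrAC z).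
apply: le_trans (enormD _ _) _; rewrite enormZ (gtr0_norm t0) enormN.
have : t <= (del - enorm (z - x)) / enorm w by rewrite ge_min lexx orbT.
by rewrite ler_pdivlMr //; lra.
Qed.

Lemma gt_nat_cvgy (u : nat -> R) : (forall k, k%:R < u k) -> u @ \oo --> +oo.
Proof.
move=> Hu; apply/cvgryPge => A; exists (Num.truncn `|A|).+1 => // k /= Ak.
apply: le_trans (ler_norm A) (le_trans _ (ltW (Hu k))).
apply: le_trans (ltW (truncnS_gt `|A|)) _.
by rewrite ler_nat.
Qed.

Lemma cvg_enorm_lt_invS (z : nat -> 'cV[R]_n) x :
  (forall k, enorm (z k - x) < k.+1%:R^-1) -> z @ \oo --> x.
Proof.
move=> Hz; apply/cvg_enormP => eps e0.
have := near_infty_natSinv_lt (PosNum e0); apply: filterS => k.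
exact: lt_trans (Hz k).
Qed.

Section Smoothing.
Variables (F : 'cV[R]_n -> R) (Fs : R -> 'cV[R]_n -> R) (G : R -> 'cV[R]_n -> 'cV[R]_n).
Hypothesis SF : smoothing_family F Fs G.

Lemma smoothing_cvg (z : nat -> 'cV[R]_n) (rho : nat -> R) x :
  z @ \oo --> x -> rho @ \oo --> +oo -> (fun k => Fs (rho k) (z k)) @ \oo --> F x.
Proof.
move=> /cvg_enormP zx /cvgryPgt rhoo; apply/cvgrPdist_lt => eps e0.
have [del [M [d0 H]]] := SF.2.1 x eps e0.
have := zx _ d0; have := rhoo M; apply: filterS2 => k a b.
by rewrite distrC; apply: H.
Qed.

(* The minimizers of [Fs rho + C |. - x|^2] on a small ball cluster at points
   [zb] with [C |zb - x|^2 <= F x - F zb <= L |zb - x|]; for large [C] they are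
   therefore interior, with gradient [-2 C (z - x)] of norm at most about [2 L]. *)
Lemma smoothing_small_grad x (L del0 del : R) : 0 <= L -> 0 < del -> del < del0 ->
  (forall y z, enorm (y - x) < del0 -> enorm (z - x) < del0 ->
     `|F y - F z| <= L * enorm (y - z)) ->
  exists M : R, forall rho, M < rho ->
    exists2 z, enorm (z - x) < del & enorm (G rho z) < 2 * L + 1.
Proof.
move=> L0 d0 dd0 HL; apply: contrapT => nM.
have {}nM k : exists rho : R, k%:R < rho /\
    forall z, enorm (z - x) < del -> 2 * L + 1 <= enorm (G rho z).
  apply: contrapT => nk; apply: nM; exists k%:R => rho krho.
  apply: contrapT => nz; apply: nk; exists rho; split => // z zx.
  by rewrite leNgt; apply/negP => Gz; apply: nz; exists z.
have [rho Hrho] := choice nM.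
have rhoo : rho @ \oo --> +oo by apply: gt_nat_cvgy => k; have [] := Hrho k.
have rho0 k : 0 < rho k by have [+ _] := Hrho k; exact: le_lt_trans.
(* With this steepness, [C * enorm d <= L] forces [enorm d < del], so the limit of the minimizers is
   interior. *)
pose C := (L + 1) / del.
have C0 : 0 < C by rewrite divr_gt0 //; lra.
have minz k : exists z, enorm (z - x) <= del /\ forall y, enorm (y - x) <= del ->
    Fs (rho k) z + C * enorm (z - x) ^+ 2 <= Fs (rho k) y + C * enorm (y - x) ^+ 2.
  have [] := @compact_EVT_min _ R (fun z => Fs (rho k) z + C * enorm (z - x) ^+ 2)
    _ _ (enorm_ball_compact x del) _.
  - by exists x; rewrite /= subrr enorm0 ltW.
  - apply: continuous_subspaceT => y.
    have cn := enorm_sub_continuous x y.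
    exact: cvgD (C1_continuous _ _ (SF.1 _ (rho0 k)) y) (cvgM (cvg_cst C) (cvgM cn cn)).
  - move=> z; rewrite inE => zx zmin; exists z; split => // y yx.
    by apply: zmin; rewrite inE.
have [z Hz] := choice minz.
have [|phi iphi [d zd]] := bolzano_weierstrass_cV _ (fun k => z k - x) del.
  by move=> k; have [] := Hz k.
pose zb := x + d.
have zphi : (fun k => z (phi k)) @ \oo --> zb.
  have : (fun k => x + (z (phi k) - x)) @ \oo --> zb.
    by apply: cvgD zd; exact: cvg_cst.
  by apply: cvg_trans; apply: near_eq_cvg; apply: nearW => k; rewrite addrC subrK.
have phioo := ge_id_cvg _ (increasing_seq_ge_id _ iphi).
have rphi : (fun k => rho (phi k)) @ \oo --> +oo := cvg_comp phi rho phioo rhoo.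
have nd : (fun k => enorm (z (phi k) - x)) @ \oo --> enorm d by exact: cvg_enorm.
have ddel : enorm d <= del.
  apply: (ler_cvg_to nd (cvg_cst del)); apply: nearW => k.
  by have [] := Hz (phi k).
have Hd : F zb + C * enorm d ^+ 2 <= F x.
  have c1 : (fun k => Fs (rho (phi k)) (z (phi k)) + C * enorm (z (phi k) - x) ^+ 2)
      @ \oo --> F zb + C * enorm d ^+ 2.
    apply: cvgD; first exact: smoothing_cvg.
    apply: cvgM; first exact: cvg_cst.
    exact: (cvgM nd nd).
  have c2 : (fun k => Fs (rho (phi k)) x) @ \oo --> F x.
    by apply: smoothing_cvg => //; exact: cvg_cst.
  apply: (ler_cvg_to c1 c2); apply: nearW => k.
  have [_ /(_ x)] := Hz (phi k).
  by rewrite subrr enorm0 expr0n mulr0 addr0; apply; exact: ltW.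
have Cd : C * enorm d <= L.
  have [-> | dn0] := eqVneq d 0; first by rewrite enorm0 mulr0.
  have dp := enorm_gt0 _ dn0.
  have := HL x zb; rewrite subrr enorm0 /zb (addrAC x) subrr add0r.
  have -> : x - (x + d) = - d by rewrite opprD addrA subrr add0r.
  rewrite enormN => /(_ (lt_trans d0 dd0) (le_lt_trans ddel dd0)).
  rewrite ler_norml -/zb => /andP[_ H].
  by rewrite -(ler_pM2r dp) -mulrA -expr2; lra.
have dlt : enorm d < del.
  move: Cd; rewrite /C mulrAC ler_pdivrMr //.
  have := enorm_ge0 d; nra.
have : \forall k \near \oo, enorm (z (phi k) - x) < del /\
    2 * C * enorm (z (phi k) - x) < 2 * L + 1.
  apply: filterI; first by have /cvgr_lt/(_ _ dlt) := nd.
  have nd2 : (fun k => 2 * C * enorm (z (phi k) - x)) @ \oo --> 2 * C * enorm d.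
    by apply: cvgM nd; exact: cvg_cst.
  by have /cvgr_lt := nd2; apply; lra.
case/filter_ex => k [zk1 zk2].
have [_ /(_ _ zk1)] := Hrho (phi k).
have [_ zmin] := Hz (phi k).
rewrite (interior_min_grad _ _ _ _ _ _ (SF.1 _ (rho0 (phi k))) zk1 zmin).
have C2 : 0 < 2 * C by rewrite mulr_gt0.
by rewrite enormN enormZ (gtr0_norm C2) leNgt zk2.
Qed.

(* Otherwise the intermediate value theorem along segments produces gradients
   of a fixed norm [2 L + 2] at points converging to [x]; a limit of these would
   be an element of the Clarke gradient of norm larger than [L]. *)
Lemma smoothing_grad_bounded x : locally_lipschitz F ->
  exists del M T : R, 0 < del /\
    forall z rho, enorm (z - x) < del -> M < rho -> enorm (G rho z) <= T.
Proof.
move=> /(_ x)[L0 [del0 [d0 HL0]]].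
(* The constant given by [locally_lipschitz] carries no sign. *)
pose L := Num.max L0 0.
have HL y z : enorm (y - x) < del0 -> enorm (z - x) < del0 ->
    `|F y - F z| <= L * enorm (y - z).
  move=> yx zx; apply: le_trans (HL0 _ _ yx zx) _.
  by rewrite ler_wpM2r ?enorm_ge0 // le_max lexx.
have L_ge0 : 0 <= L by rewrite le_max lexx orbT.
pose T := 2 * L + 2.
apply: contrapT => nB.
have ex k : exists zr : 'cV[R]_n * R, [/\ enorm (zr.1 - x) < k.+1%:R^-1, k%:R < zr.2 &
    enorm (G zr.2 zr.1) = T].
  (* The first entry makes the points found converge to [x], the second stays inside the Lipschitz
     ball. *)
  pose e := Num.min k.+1%:R^-1 (del0 / 2).
  have e0 : 0 < e by rewrite lt_min invr_gt0 ltr0n divr_gt0.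
  have ed0 : e < del0 by rewrite gt_min; apply/orP; right; lra.
  have [M HM] := smoothing_small_grad x L del0 e L_ge0 e0 ed0 HL.
  have [z [rho [zx rhoM GT]]] : exists z rho,
      [/\ enorm (z - x) < e, Num.max k%:R M < rho & T < enorm (G rho z)].
    apply: contrapT => nz; apply: nB; exists e, (Num.max k%:R M), T; split => //.
    move=> z rho zx rhoM; rewrite leNgt; apply/negP => GT.
    by apply: nz; exists z, rho.
  move: rhoM; rewrite gt_max => /andP[rhok rhoM].
  have rho0 : 0 < rho by exact: le_lt_trans rhok.
  have [z' z'x Gz'] := HM _ rhoM.
  have cG : continuous (fun s : R => enorm (G rho (z' + s *: (z - z')))).
    move=> s; apply: cvg_enorm.
    exact: (continuous_comp (continuous_line z' (z - z') s) ((SF.1 _ rho0).2 _)).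
  have [|s] := @IVT R _ 0 1 T ler01 (continuous_subspaceT cG).
    rewrite scale0r addr0 scale1r addrC subrK ge_min le_max.
    rewrite (ltW GT) orbT andbT; apply/orP; left; rewrite /T; lra.
  (* The intermediate point is a convex combination of two points of the ball, hence again in it. *)
  rewrite in_itv /= => /andP[s0 s1] GsT.
  exists (z' + s *: (z - z'), rho); split => //=.
  have -> : z' + s *: (z - z') - x = (1 - s) *: (z' - x) + s *: (z - x).
    by apply/matrixP => i j; rewrite !mxE; ring.
  apply: lt_le_trans (_ : e <= _); last by rewrite ge_min lexx.
  apply: le_lt_trans (enormD _ _) _; rewrite !enormZ !ger0_norm ?subr_ge0 //.
  have [-> | sn0] := eqVneq s 0; first by rewrite subr0 mul1r mul0r addr0.
  have sp : 0 < s by rewrite lt0r sn0.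
  have := ler_wpM2l (_ : 0 <= 1 - s) (ltW z'x); rewrite subr_ge0 => /(_ s1).
  have : s * enorm (z - x) < s * e by rewrite ltr_pM2l.
  lra.
have [zr Hzr] := choice ex.
have [|phi iphi [v Gv]] := bolzano_weierstrass_cV _ (fun k => G (zr k).2 (zr k).1) T.
  by move=> k; have [_ _ ->] := Hzr k.
have phioo := ge_id_cvg _ (increasing_seq_ge_id _ iphi).
have zx : (fun k => (zr k).1) @ \oo --> x.
  by apply: cvg_enorm_lt_invS => k; have [] := Hzr k.
have roo : (fun k => (zr k).2) @ \oo --> +oo.
  by apply: gt_nat_cvgy => k; have [] := Hzr k.
have cv : clarke_grad F x v.
  have [_] := SF.2.2 x; apply; [exact: (cvg_comp phi _ phioo zx)
    |exact: (cvg_comp phi _ phioo roo)|exact: Gv].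
have vT : enorm v = T.
  have : (fun k => enorm (G (zr (phi k)).2 (zr (phi k)).1)) @ \oo --> enorm v.
    exact: cvg_enorm.
  have -> : (fun k => enorm (G (zr (phi k)).2 (zr (phi k)).1)) = cst T.
    by apply/funext => k; have [] := Hzr (phi k).
  by move=> H; apply: (cvg_unique (@Rhausdorff R) H); exact: cvg_cst.
have := clarke_grad_enorm_le _ _ _ _ _ d0 HL cv; rewrite vT /T.
nra.
Qed.

End Smoothing.
End GradientBound.

(** * Limits of inner products and common subsequences *)

Section Limits.
Context {R : realType}.

Lemma cvg_dotv n (u v : nat -> 'cV[R]_n) a b :
  u @ \oo --> a -> v @ \oo --> b -> (fun k => dotv (u k) (v k)) @ \oo --> dotv a b.
Proof.
move=> ua vb; have -> : (fun k => dotv (u k) (v k)) = fun k => \sum_i u k i 0 * v k i 0.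
  by apply/funext => k; rewrite dotvE.
rewrite dotvE; apply: cvg_big => [|i _]; first exact: add_continuous.
by apply: cvgM; [exact: cvg_comp ua (@coord_continuous _ _ _ i 0 a)
  |exact: cvg_comp vb (@coord_continuous _ _ _ i 0 b)].
Qed.

(** Bounds holding only eventually are handled by a shift; [k <= phi k] is all that is retained,
    enough to carry existing limits along [phi]. *)
Lemma bolzano_weierstrass_near (I : finType) (u : nat -> I -> R) (B : I -> R) :
  (forall i, \forall k \near \oo, `|u k i| <= B i) ->
  exists2 phi : nat -> nat, (forall k, (k <= phi k)%N) &
    exists l : I -> R, forall i, (fun k => u (phi k) i) @ \oo --> l i.
Proof.
move=> uB.
have [N _ HN] : \forall k \near \oo, forall i, `|u k i| <= B i by exact: filter_forall.
have [k i|phi iphi [l Hl]] := bolzano_weierstrass_fin _ (fun k => u (N + k)%N) B.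
  by apply: HN => /=; rewrite leq_addr.
exists (fun k => N + phi k)%N; last by exists l.
by move=> k; apply: leq_trans (increasing_seq_ge_id _ iphi k) (leq_addl _ _).
Qed.

Lemma cvg_eq (V : normedModType R) (u : nat -> V) a b :
  u @ \oo --> a -> (\forall k \near \oo, u k = b) -> a = b.
Proof.
move=> ua ub; apply: (cvg_unique (@norm_hausdorff _ V) ua).
exact: cvg_near_cst.
Qed.

End Limits.

(** * Passage to the limit in the KKT system *)

Section Stationarity.
Context {R : realType} {n p me : nat}.
Variables (f : 'cV[R]_n -> R) (g : 'I_p -> 'cV[R]_n -> R) (h : 'I_me -> 'cV[R]_n -> R).
Variables (fs : R -> 'cV[R]_n -> R) (gs : 'I_p -> R -> 'cV[R]_n -> R)
  (hs : 'I_me -> R -> 'cV[R]_n -> R).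
Variables (Gf : R -> 'cV[R]_n -> 'cV[R]_n) (Gg : 'I_p -> R -> 'cV[R]_n -> 'cV[R]_n)
  (Gh : 'I_me -> R -> 'cV[R]_n -> 'cV[R]_n).
Hypotheses (Lf : locally_lipschitz f) (Lg : forall i, locally_lipschitz (g i))
  (Lh : forall j, locally_lipschitz (h j)).
Hypotheses (Sf : smoothing_family f fs Gf)
  (Sg : forall i, smoothing_family (g i) (gs i) (Gg i))
  (Sh : forall j, smoothing_family (h j) (hs j) (Gh j)).

Lemma near_smoothing_grad_bounded F Fs G (y : nat -> 'cV[R]_n) (rho : nat -> R)
    (y0 : 'cV[R]_n) :
  smoothing_family F Fs G -> locally_lipschitz F ->
  y @ \oo --> y0 -> rho @ \oo --> +oo ->
  exists T : R, \forall k \near \oo, enorm (G (rho k) (y k)) <= T.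
Proof.
move=> SF LF /cvg_enormP yy0 /cvgryPgt rhoo.
have [del [M [T [d0 HT]]]] := smoothing_grad_bounded _ _ _ SF y0 LF.
exists T; have := yy0 _ d0; have := rhoo M; apply: filterS2 => k a b; exact: HT.
Qed.

(** Here [w] stands for the term [W d], and [lh] for the difference of the two multipliers of an
    equality constraint. Gradient consistency places the limits of the gradients in the Clarke
    gradients. *)
Lemma kkt_limit_stationary (x d w : nat -> 'cV[R]_n) (rho xi : nat -> R)
    (lg : nat -> 'I_p -> R) (lh : nat -> 'I_me -> R) (xbar : 'cV[R]_n) (B : R) :
  x @ \oo --> xbar -> rho @ \oo --> +oo -> d @ \oo --> (0 : 'cV[R]_n) ->
  w @ \oo --> (0 : 'cV[R]_n) -> xi @ \oo --> (0 : R) ->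
  (forall k i, 0 <= lg k i <= B) -> (forall k j, `|lh k j| <= B) ->
  (forall k, qp_feasible gs hs Gg Gh (rho k) (x k) (d k) (xi k)) ->
  (forall k, Gf (rho k) (x k) + w k + \sum_(i < p) lg k i *: Gg i (rho k) (x k)
    + \sum_(j < me) lh k j *: Gh j (rho k) (x k) = 0) ->
  (forall k i, lg k i * (gs i (rho k) (x k) + dotv (Gg i (rho k) (x k)) (d k) - xi k) = 0) ->
  stationary f g h xbar.
Proof.
move=> xx roo d0 w0 xi0 lgB lhB feas stat compl.
have [Tf HTf] := near_smoothing_grad_bounded _ _ _ _ _ _ Sf Lf xx roo.
have [Tg HTg] := choice (fun i => near_smoothing_grad_bounded _ _ _ _ _ _ (Sg i) (Lg i) xx roo).
have [Th HTh] := choice (fun j => near_smoothing_grad_bounded _ _ _ _ _ _ (Sh j) (Lh j) xx roo).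
(* All gradient coordinates and multipliers are gathered into one finite family, so that a single
   extraction makes everything converge. *)
pose I : finType := ('I_n + ('I_p * 'I_n + ('I_me * 'I_n + ('I_p + 'I_me))))%type.
pose u k (s : I) : R := match s with
  | inl a => Gf (rho k) (x k) a 0
  | inr (inl (i, a)) => Gg i (rho k) (x k) a 0
  | inr (inr (inl (j, a))) => Gh j (rho k) (x k) a 0
  | inr (inr (inr (inl i))) => lg k i
  | inr (inr (inr (inr j))) => lh k j
  end.
pose Bu (s : I) : R := match s with
  | inl _ => Tf | inr (inl (i, _)) => Tg i | inr (inr (inl (j, _))) => Th j
  | _ => B end.
have [|phi phik [l Hl]] := bolzano_weierstrass_near I u Bu.
  move=> [a|[[i a]|[[j a]|[i|j]]]] /=.
  - by apply: filterS HTf => k; apply: le_trans; exact: coord_le_enorm.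
  - by apply: filterS (HTg i) => k; apply: le_trans; exact: coord_le_enorm.
  - by apply: filterS (HTh j) => k; apply: le_trans; exact: coord_le_enorm.
  - by apply: nearW => k; have /andP[? ?] := lgB k i; rewrite ger0_norm.
  - exact: nearW.
have phioo := ge_id_cvg _ phik.
have {}xx := cvg_comp phi x phioo xx.
have {}roo := cvg_comp phi rho phioo roo.
have {}d0 := cvg_comp phi d phioo d0.
have {}w0 := cvg_comp phi w phioo w0.
have {}xi0 := cvg_comp phi xi phioo xi0.
pose zf : 'cV[R]_n := \col_a l (inl a).
pose zg i : 'cV[R]_n := \col_a l (inr (inl (i, a))).
pose zh j : 'cV[R]_n := \col_a l (inr (inr (inl (j, a)))).
pose mg i := l (inr (inr (inr (inl i)))).
pose mh j := l (inr (inr (inr (inr j)))).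
have cf : (fun k => Gf (rho (phi k)) (x (phi k))) @ \oo --> zf.
  by apply: cvg_coord => a; rewrite mxE; exact: Hl (inl a).
have cg i : (fun k => Gg i (rho (phi k)) (x (phi k))) @ \oo --> zg i.
  by apply: cvg_coord => a; rewrite mxE; exact: Hl (inr (inl (i, a))).
have ch j : (fun k => Gh j (rho (phi k)) (x (phi k))) @ \oo --> zh j.
  by apply: cvg_coord => a; rewrite mxE; exact: Hl (inr (inr (inl (j, a)))).
have cmg i : (fun k => lg (phi k) i) @ \oo --> mg i by exact: Hl (inr (inr (inr (inl i)))).
have cmh j : (fun k => lh (phi k) j) @ \oo --> mh j by exact: Hl (inr (inr (inr (inr j)))).
have cgx i : (fun k => gs i (rho (phi k)) (x (phi k))
      + dotv (Gg i (rho (phi k)) (x (phi k))) (d (phi k)))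
    @ \oo --> g i xbar.
  have -> : g i xbar = g i xbar + dotv (zg i) 0 by rewrite dotvC dotv0l addr0.
  exact: cvgD (smoothing_cvg _ _ _ (Sg i) _ _ _ xx roo) (cvg_dotv _ _ _ _ _ (cg i) d0).
have chx j : (fun k => hs j (rho (phi k)) (x (phi k))
      + dotv (Gh j (rho (phi k)) (x (phi k))) (d (phi k)))
    @ \oo --> h j xbar.
  have -> : h j xbar = h j xbar + dotv (zh j) 0 by rewrite dotvC dotv0l addr0.
  exact: cvgD (smoothing_cvg _ _ _ (Sh j) _ _ _ xx roo) (cvg_dotv _ _ _ _ _ (ch j) d0).
have compl_lim i : mg i * g i xbar = 0.
  rewrite -[g i xbar]subr0.
  apply: (cvg_eq _ _ _ _ (cvgM (cmg i) (cvgB (cgx i) xi0))).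
  by apply: nearW => k; exact: compl.
split.
  split => [i|j].
    apply: (ler_cvg_to (cgx i) xi0); apply: nearW => k.
    by have [fg _] := feas (phi k); exact: fg.
  apply/eqP; rewrite eq_le; apply/andP; split.
    apply: (ler_cvg_to (chx j) xi0); apply: nearW => k.
    by have [_ [/(_ j)[]]] := feas (phi k).
  rewrite -oppr_le0.
  apply: (ler_cvg_to (cvgN (chx j)) xi0); apply: nearW => k.
  by have [_ [/(_ j)[_]]] := feas (phi k); rewrite /= opprD.
exists mg, mh, zf, zg, zh; split; first exact: (Sf.2.2 xbar).2 cf.
split.
  move=> i _; split; last exact: ((Sg i).2.2 xbar).2 (cg i).
  apply: (ler_cvg_to (cvg_cst 0) (cmg i)); apply: nearW => k.
  by have /andP[] := lgB (phi k) i.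
split; first by move=> j; exact: ((Sh j).2.2 xbar).2 (ch j).
(* Off the active set [mg i] vanishes by [compl_lim], so the active sum equals the full sum that
   arises as a limit. *)
rewrite big_mkcond /= (eq_bigr (fun i => mg i *: zg i)); last first.
  move=> i _; case: eqP => // gi0; have /eqP := compl_lim i.
  by rewrite mulf_eq0 => /orP[/eqP ->|/eqP//]; rewrite scale0r.
rewrite -[zf]addr0.
have cs1 : (fun k => \sum_(i < p) lg (phi k) i *: Gg i (rho (phi k)) (x (phi k)))
    @ \oo --> \sum_(i < p) mg i *: zg i.
  apply: cvg_big => [|i _]; first exact: add_continuous.
  exact: cvgZ (cmg i) (cg i).
have cs2 : (fun k => \sum_(j < me) lh (phi k) j *: Gh j (rho (phi k)) (x (phi k)))
    @ \oo --> \sum_(j < me) mh j *: zh j.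
  apply: cvg_big => [|j _]; first exact: add_continuous.
  exact: cvgZ (cmh j) (ch j).
apply: (cvg_eq _ _ _ _ (cvgD (cvgD (cvgD cf w0) cs1) cs2)).
by apply: nearW => k; exact: stat.
Qed.

End Stationarity.

(** * Assembly: descent, infinitude of the index set, stationarity *)

Theorem theorem3p1 (R : realType) (n p me : nat)
  (f : 'cV[R]_n -> R) (g : 'I_p -> 'cV[R]_n -> R) (h : 'I_me -> 'cV[R]_n -> R)
  (fs : R -> 'cV[R]_n -> R) (gs : 'I_p -> R -> 'cV[R]_n -> R)
  (hs : 'I_me -> R -> 'cV[R]_n -> R)
  (Gf : R -> 'cV[R]_n -> 'cV[R]_n) (Gg : 'I_p -> R -> 'cV[R]_n -> 'cV[R]_n)
  (Gh : 'I_me -> R -> 'cV[R]_n -> 'cV[R]_n)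
  (beta sigma1 sigma2 sigma sigma' etahat : R)
  (x : nat -> 'cV[R]_n) (rho : nat -> R) (d : nat -> 'cV[R]_n) (xi : nat -> R)
  (lg : nat -> 'I_p -> R) (lp lm : nat -> 'I_me -> R) (lx : nat -> R)
  (r : nat -> R) (W : nat -> 'M[R]_n) :
  locally_lipschitz f -> (forall i, locally_lipschitz (g i)) ->
  (forall j, locally_lipschitz (h j)) ->
  smoothing_family f fs Gf -> (forall i, smoothing_family (g i) (gs i) (Gg i)) ->
  (forall j, smoothing_family (h j) (hs j) (Gh j)) ->
  (* Part (1) *)
  (forall k : nat,
     alg31_upto fs gs hs Gf Gg Gh beta sigma1 sigma2 sigma sigma' etahat
       x rho d xi lg lp lm lx r W k ->
     (exists l : R, dir_deriv (theta fs gs hs (rho k) (r k)) (x k) (d k) l /\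
                    l <= - quadf (W k) (d k)) /\
     (assumption31 W -> d k != 0 ->
        descent_direction (theta fs gs hs (rho k) (r k)) (x k) (d k)))
  /\
  (* Part (2) *)
  (assumption31 W ->
   (forall K : nat,
      alg31_upto fs gs hs Gf Gg Gh beta sigma1 sigma2 sigma sigma' etahat
        x rho d xi lg lp lm lx r W K) ->
   (exists B : R, forall k, enorm (x k) <= B) ->
   (exists B : R, forall k, (forall i, `|lg k i| <= B) /\
                            (forall j, `|lp k j| <= B /\ `|lm k j| <= B) /\
                            `|lx k| <= B) ->
   (exists B : R, forall k, `|r k| <= B) ->
   (forall N : nat, exists k : nat, (N <= k)%N /\ enorm (d k) <= etahat / rho k) /\
   (forall xbar : 'cV[R]_n,
      (forall eps : R, 0 < eps -> forall N : nat, exists k : nat,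
         [/\ (N <= k)%N, enorm (d k) <= etahat / rho k & enorm (x k - xbar) < eps]) ->
      stationary f g h xbar)).
Proof.
move=> Lf Lg Lh Sf Sg Sh.
have Cf := Sf.1; have Cg i := (Sg i).1; have Ch j := (Sh j).1.
split.
  move=> k [[_ _ _ _ [sg1 _ _]] [rho0 [_ [iter step]]]].
  have rhoP j : (j <= k)%N -> 0 < rho j.
    elim: j => [//|j IHj jk]; have [_ _ ->] := step j jk.
    have rj := IHj (ltnW jk); case: ifP => // _.
    by rewrite mulr_gt0 // (lt_trans ltr01).
  have [[_ Wpos] [[feas _] kkt]] := iter k (leqnn k).
  have [l [ddl lW]] := theta_dir_deriv_le _ _ _ _ _ _ Cf Cg Ch _ _ _ _ _ _ _ _ _ _
    (rhoP k (leqnn k)) feas kkt.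
  split; first by exists l.
  move=> _ dk; apply: (dir_deriv_lt0_descent _ _ _ _ ddl).
  by apply: le_lt_trans lW _; rewrite oppr_lt0 Wpos.
move=> [m [M [/andP[m0 mM] HW]]] alg [Bx HBx] [Bl HBl] [Br HBr].
have [[beta01 sig01 _ _ [sg1 sg'1 eta1]] [rho0 [r0 _]]] := alg 0%N.
have iter k : sym_posdef (W k) /\
    qp_solution gs hs Gf Gg Gh (rho k) (x k) (W k) (r k) (d k) (xi k) /\
    qp_kkt gs hs Gf Gg Gh (rho k) (x k) (W k) (r k) (d k) (xi k) (lg k) (lp k) (lm k) (lx k).
  by have [_ [_ [_ [+ _]]]] := alg k; apply.
(* A run up to [K] records updates only at indices strictly below [K], hence the run up to
   [k.+1]. *)
have step k := (alg k.+1).2.2.2.2 k (ltnSn k).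
have kkt k := (iter k).2.2.
have feas k := (iter k).2.1.1.
have [rhoP rhooo] : (forall k, 0 < rho k) /\
    ((forall N, exists k, (N <= k)%N /\ enorm (d k) <= etahat / rho k) -> rho @ \oo --> +oo).
  by apply: (geometric_growth rho sigma) => // k; have [_ _] := step k.
(* Each nonzero [xi k] multiplies [r] by [sigma']; infinitely many would contradict the bound on
   [r]. *)
have [N0 xi0] : exists N, forall k, (N <= k)%N -> xi k = 0.
  have [rP roo] := geometric_growth r sigma' (fun k => xi k != 0) r0 sg'1
    (fun k => ltac:(by have [-> _ _] := step k; case: eqP)).
  apply: contrapT => nN.
  have /cvgryPgt/(_ Br)/filter_ex[k] : r @ \oo --> +oo.
    apply: roo => N; apply: contrapT => nk; apply: nN; exists N => k Nk.
    by apply/eqP; apply: contrapT => /negP xik; apply: nk; exists k.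
  by rewrite ltNge (le_trans (ler_norm _) (HBr k)).
pose B := Num.max Bl 0.
have B0 : 0 <= B by rewrite le_max lexx orbT.
have BlB : Bl <= B by rewrite le_max lexx.
have HB k : (forall i, `|lg k i| <= B) /\ (forall j, `|lp k j| <= B /\ `|lm k j| <= B).
  have [Hg [Hpm _]] := HBl k; split => [i|j]; first exact: le_trans (Hg i) BlB.
  by have [Hp Hm] := Hpm j; split; [exact: le_trans Hp BlB|exact: le_trans Hm BlB].
have Kinf : forall N : nat, exists k : nat, (N <= k)%N /\ enorm (d k) <= etahat / rho k.
  move=> N1; apply: contrapT => nK.
  have {}nK k : (N1 <= k)%N -> etahat / rho k < enorm (d k).
    by move=> N1k; rewrite ltNge; apply/negP => dk; apply: nK; exists k.
  (* From [N] on neither [r] nor [rho] changes, and the steps stay above [etahat / rho N], so the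
     line-search contradiction applies to the shifted sequence. *)
  pose N := maxn N0 N1.
  have NN0 k : (N0 <= N + k)%N by rewrite (leq_trans (leq_maxl _ _) (leq_addr _ _)).
  have NN1 k : (N1 <= N + k)%N by rewrite (leq_trans (leq_maxr _ _) (leq_addr _ _)).
  have rhoN k : rho (N + k)%N = rho N.
    elim: k => [|k IHk]; first by rewrite addn0.
    have [_ _] := step (N + k)%N; rewrite addnS => ->.
    by rewrite leNgt nK //= IHk.
  have rN k : r (N + k)%N = r N.
    elim: k => [|k IHk]; first by rewrite addn0.
    by have [+ _ _] := step (N + k)%N; rewrite addnS xi0 // eqxx => ->.
  apply: (@armijo_steps_not_bounded_below R n p me fs gs hs Gf Gg Gh Cf Cg Ch
    (rho N) (r N) beta sigma1 (fun k => x (N + k)%N) (fun k => d (N + k)%N)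
    (fun k => xi (N + k)%N) (fun k => lg (N + k)%N) (fun k => lp (N + k)%N)
    (fun k => lm (N + k)%N) (fun k => lx (N + k)%N) (fun k => W (N + k)%N)
    m Bx B (etahat / rho N)) => //.
  - by rewrite divr_gt0 // (lt_trans ltr01).
  - by move=> k v; have /andP[] := HW (N + k)%N v.
  - by move=> k; rewrite -(rhoN k) ltW // nK.
  - by move=> k; have := feas (N + k)%N; rewrite rhoN.
  - by move=> k; have := kkt (N + k)%N; rewrite rhoN rN.
  - by move=> k; have [_ + _] := step (N + k)%N; rewrite addnS rhoN rN.
split => // xbar acc.
have {}rhooo := rhooo Kinf.
(* Starting at [N0 + l] secures both [xi k = 0] and indices tending to infinity. *)
have ex l : exists k, [/\ (N0 + l <= k)%N, enorm (d k) <= etahat / rho k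
    & enorm (x k - xbar) < l.+1%:R^-1].
  by apply: acc; rewrite invr_gt0 ltr0n.
have [kap Hkap] := choice ex.
have kapoo : kap @ \oo --> \oo.
  by apply: ge_id_cvg => l; have [+ _ _] := Hkap l; apply: leq_trans; rewrite leq_addl.
have roo : (rho \o kap) @ \oo --> +oo := cvg_comp kap rho kapoo rhooo.
have d0 : (d \o kap) @ \oo --> (0 : 'cV[R]_n).
  apply/cvg_enormP => eps e0; have /cvgryPgt/(_ (etahat / eps)) := roo.
  apply: filterS => l /= rl; rewrite subr0; have [_ dl _] := Hkap l.
  by apply: le_lt_trans dl _; rewrite ltr_pdivrMr // mulrC -ltr_pdivrMr.
apply: (kkt_limit_stationary f g h fs gs hs Gf Gg Gh Lf Lg Lh Sf Sg Sh (x \o kap)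
  (d \o kap) (fun l => W (kap l) *m d (kap l)) (rho \o kap) (xi \o kap)
  (fun l => lg (kap l)) (fun l j => lp (kap l) j - lm (kap l) j) xbar (2 * B)) => //.
- by apply: cvg_enorm_lt_invS => l; have [] := Hkap l.
- apply/cvg_enormP => eps e0.
  (* The uniform upper bound of the quadratic forms gives [enorm (W d) <= M * enorm d], so this term
     vanishes with [d]. *)
  have M0 : 0 < M by exact: lt_trans mM.
  have /cvg_enormP/(_ (eps / M)) := d0; rewrite divr_gt0 // => /(_ isT).
  apply: filterS => l /=; rewrite !subr0 ltr_pdivlMr // mulrC; apply: le_lt_trans.
  apply: enorm_mulmx_le; first exact: (iter (kap l)).1.1.
  move=> u; have /andP[q1 ->] := HW (kap l) u; rewrite andbT.
  by apply: le_trans q1; rewrite mulr_ge0 ?exprn_ge0 ?enorm_ge0 // ltW.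
- apply: cvg_near_cst; apply: nearW => l /=; apply: xi0.
  by have [+ _ _] := Hkap l; apply: leq_trans; rewrite leq_addr.
- move=> l i; have [Hg _] := HB (kap l); have [-> _] := kkt (kap l).
  by rewrite (le_trans (ler_norm _)) // (le_trans (Hg i)) //; lra.
- move=> l j; have [_ /(_ j)[Hp Hm]] := HB (kap l).
  by apply: le_trans (ler_normB _ _) _; lra.
- by move=> l; exact: feas.
- by move=> l; have [_ [_ [_ [+ _]]]] := kkt (kap l).
- by move=> l i; have [_ [_ [_ [_ [_ [+ _]]]]]] := kkt (kap l); apply.
Qed.
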